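(* Let $L\in\mathcal{L}$ and consider the power mean reversiblizations $P_p$ of $L$ with $p\in\{-\infty,-1,0,1,2,\infty\}$. Then: (1) (Hitting times) For $\lambda>0$ and $A\subseteq\mathcal{X}$, $$\mathbb{E}_{\pi}(e^{-\lambda\tau_A(P_{-\infty})})\le\mathbb{E}_{\pi}(e^{-\lambda\tau_A(P_{-1})})\le\mathbb{E}_{\pi}(e^{-\lambda\tau_A(P_0)})\le\mathbb{E}_{\pi}(e^{-\lambda\tau_A(P_1)})\le\mathbb{E}_{\pi}(e^{-\lambda\tau_A(P_2)})\le\mathbb{E}_{\pi}(e^{-\lambda\tau_A(P_\infty)}).$$ In particular, for any $A\subseteq\mathcal{X}$, $$\mathbb{E}_{\pi}(\tau_A(P_{-\infty}))\ge\mathbb{E}_{\pi}(\tau_A(P_{-1}))\ge\mathbb{E}_{\pi}(\tau_A(P_0))\ge\mathbb{E}_{\pi}(\tau_A(P_1))\ge\mathbb{E}_{\pi}(\tau_A(P_2))\ge\mathbb{E}_{\pi}(\tau_A(P_\infty)).$$ Furthermore, $$t_{av}(P_{-\infty},\pi)\ge t_{av}(P_{-1},\pi)\ge t_{av}(P_0,\pi)\ge t_{av}(P_1,\pi)\ge t_{av}(P_2,\pi)\ge t_{av}(P_\infty,\pi).$$ (2) (Spectral gap) $$\lambda_2(P_{-\infty},\pi)\le\lambda_2(P_{-1},\pi)\le\lambda_2(P_0,\pi)\le\lambda_2(P_1,\pi)\le\lambda_2(P_2,\pi)\le\lambda_2(P_\infty,\pi),$$ that is, $$t_{rel}(P_{-\infty},\pi)\ge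 t_{rel}(P_{-1},\pi)\ge t_{rel}(P_0,\pi)\ge t_{rel}(P_1,\pi)\ge t_{rel}(P_2,\pi)\ge t_{rel}(P_\infty,\pi).$$ (3) (Asymptotic variance) For $h\in\ell^2_0(\pi)=\{h:\pi(h)=0\}$, $$\sigma^2(h,P_{-\infty},\pi)\ge\sigma^2(h,P_{-1},\pi)\ge\sigma^2(h,P_0,\pi)\ge\sigma^2(h,P_1,\pi)\ge\sigma^2(h,P_2,\pi)\ge\sigma^2(h,P_\infty,\pi).$$ All the inequalities for $\mathbb{E}_\pi(e^{-\lambda\tau_A})$, $\mathbb{E}_\pi(\tau_A)$, $t_{av}$, $\lambda_2$, $t_{rel}$ and $\sigma^2$ in (1), (2) and (3) hold with equality if $L$ is $\pi$-reversible with $L=L^*$, so that all the power mean reversiblizations $P_p$ collapse to $L$.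
   Context: $\mathcal{X}$ is a finite set and $\pi$ is a fixed probability distribution on $\mathcal{X}$ with $\pi(x)>0$ for all $x$. $\mathcal{L}$ is the set of Markov infinitesimal generators on $\mathcal{X}$, i.e. $\mathcal{X}\times\mathcal{X}$ real matrices with non-negative off-diagonal entries and all row sums zero. $\mathcal{L}(\pi)\subseteq\mathcal{L}$ is the set of $\pi$-reversible generators, i.e. those $M$ with $\pi(x)M(x,y)=\pi(y)M(y,x)$ for all $x,y$. The $\pi$-dual $L_\pi$ of $L\in\mathcal{L}$ is the generator with off-diagonal entries $L_\pi(x,y)=\frac{\pi(y)}{\pi(x)}L(y,x)$, $x\neq y$, and diagonal entries such that all row sums are zero. When $L$ is $\pi$-stationary, $L_\pi=L^*$, the $\ell^2(\pi)$-adjoint of $L$. Power mean reversiblizations: for $x\neq y$, $P_p(x,y)=\left(\frac{L(x,y)^p+L_\pi(x,y)^p}{2}\right)^{1/p}$ for $p\in\mathbb{R}\setminus\{0\}$ (for $p<0$ understood by continuity as $0$ if $L(x,y)=0$ or $L_\pi(x,y)=0$), $P_0(x,y)=\sqrt{L(x,y)L_\pi(x,y)}$, $P_\infty(x,y)=\max\{L(x,y),L_\pi(x,y)\}$, $P_{-\infty}(x,y)=\min\{L(x,y),L_\pi(x,y)\}$; diagonal entries are such that all row sums are zero. Each $P_p\in\mathcal{L}(\pi)$. $\langle f,g\rangle_\pi=\sum_xf(x)g(x)\pi(x)$, $\pi(f)=\sum_xf(x)\pi(x)$. For $G\in\mathcal{L}(\pi)$ and $X=(X_t)_{t\ge0}$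 the continuous-time chain with generator $G$: $\tau_A(G)=\inf\{t\ge0:X_t\in A\}$ ($\inf\emptyset=\infty$), $\tau_y=\tau_{\{y\}}$; $\mathbb{E}_x,\mathbb{E}_\pi$ are expectations with $X_0=x$, $X_0\sim\pi$; the average hitting time is $t_{av}(G,\pi)=\sum_{x,y}\mathbb{E}_x(\tau_y)\pi(x)\pi(y)$; the spectral gap is $\lambda_2(G,\pi)=\inf\{\langle -Gf,f\rangle_\pi: f\in\mathbb{R}^{\mathcal{X}},\pi(f)=0,\pi(f^2)=1\}$; the relaxation time is $t_{rel}(G,\pi)=1/\lambda_2(G,\pi)$; for $h$ with $\pi(h)=0$, the asymptotic variance (the limiting variance of $t^{-1/2}\int_0^th(X_s)\,ds$) is $\sigma^2(h,G,\pi)=-2\langle h,g\rangle_\pi$, where $g$ solves the Poisson equation $Gg=h$. *)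

(* Defs.v *)
From HB Require Import structures.
From mathcomp Require Import all_boot all_order all_algebra.
From mathcomp Require Import all_classical all_reals all_analysis.

Set Implicit Arguments.
Unset Strict Implicit.
Unset Printing Implicit Defensive.

Import Order.TTheory GRing.Theory Num.Theory.
Import numFieldNormedType.Exports.

Local Open Scope classical_set_scope.
Local Open Scope ring_scope.

Section Generators.
Context {R : realType} {T : finType}.
Implicit Types (pi f g h : T -> R) (K L M G : T -> T -> R).

Definition is_positive_distribution pi : Prop :=
  (forall x, 0 < pi x) /\ \sum_x pi x = 1.

Definition is_generator L : Prop :=
  (forall x y, x != y -> 0 <= L x y) /\ (forall x, \sum_y L x y = 0).

Definition is_reversible_generator pi M : Prop :=
  is_generator M /\ (forall x y, pi x * M x y = pi y * M y x).

(* Keeps the off-diagonal entries of K and resets the diagonal so that all row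
   sums vanish. *)
Definition with_zero_row_sums K : T -> T -> R := fun x y =>
  if x == y then - \sum_(z | z != x) K x z else K x y.

Definition dual pi L : T -> T -> R :=
  with_zero_row_sums (fun x y => pi y / pi x * L y x).

(* For p < 0 the vanishing case must be singled out: powR satisfies
   0 `^ p = 0 rather than +oo when p < 0. *)
Definition power_mean (p : \bar R) (a b : R) : R :=
  match p with
  | EPInf => Num.max a b
  | ENInf => Num.min a b
  | EFin r =>
      if r == 0 then Num.sqrt (a * b)
      else if (r < 0) && ((a == 0) || (b == 0)) then 0
      else ((a `^ r + b `^ r) / 2) `^ r^-1
  end.

Definition power_mean_reversiblization pi L (p : \bar R) : T -> T -> R :=
  with_zero_row_sums (fun x y => power_mean p (L x y) (dual pi L x y)).

Definition dot pi f g : R := \sum_x f x * g x * pi x.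

Definition mean pi f : R := \sum_x f x * pi x.

Definition apply_gen G f : T -> R := fun x => \sum_y G x y * f y.

(* Extended-real valued: +oo when the constraint set is empty, i.e. when the
   state space has a single point. *)
Definition spectral_gap G pi : \bar R :=
  ereal_inf [set (dot pi (fun x => - apply_gen G f x) f)%:E
            | f in [set f | mean pi f = 0 /\ mean pi (fun x => f x ^+ 2) = 1]].

(* The inverse on \bar R has 0^-1 = +oo and +oo^-1 = 0; a vanishing gap does
   occur, as P_p can be reducible. *)
Definition relaxation_time G pi : \bar R := ((spectral_gap G pi)^-1)%E.

(* For reversible G, the value does not depend on the solution g of the Poisson
   equation.  The equation has no solution exactly when h is not orthogonal to
   the kernel of G (which needs G reducible); the limiting variance of
   t^(-1/2) \int_0^t h(X_s) ds is then infinite. *)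
Definition asymptotic_variance h G pi : \bar R :=
  match pselect (exists g, apply_gen G g = h) with
  | left ex_g => (- 2 * dot pi h (projT1 (cid ex_g)))%:E
  | right _ => +oo%E
  end.

Fixpoint gen_pow G (k : nat) : T -> T -> R := fun x y =>
  if k is k'.+1 then \sum_z G x z * gen_pow G k' z y else (x == y)%:R.

(* Entries of the matrix exponential exp(tG). *)
Definition semigroup G (t : R) : T -> T -> R := fun x y =>
  limn (series (fun k : nat => t ^+ k / (k`!)%:R * gen_pow G k x y)).

Definition point_mass (x : T) : T -> R := fun y => (y == x)%:R.

(* A realization, on some probability space, of the continuous-time Markov
   chain with generator G and initial law mu: right-continuous paths (for the
   discrete topology on T) and the finite-dimensional laws given by mu and
   exp(tG).  Only the values of the process at times t >= 0 are relevant. *)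
Record markov_chain G (mu : T -> R) := MarkovChain {
  mc_display : measure_display;
  mc_space : measurableType mc_display;
  mc_prob : probability mc_space R;
  mc_proc : R -> mc_space -> T;
  mc_measurable : forall (t : R) (x : T), 0 <= t ->
    measurable [set w | mc_proc t w = x];
  mc_right_continuous : forall (w : mc_space) (t : R), 0 <= t ->
    \forall s \near t^'+, mc_proc s w = mc_proc t w;
  mc_finite_dimensional : forall (n : nat) (t : nat -> R) (x : nat -> T),
    t 0%N = 0 -> (forall i, t i <= t i.+1) ->
    mc_prob [set w | forall i, (i <= n)%N -> mc_proc (t i) w = x i] =
    (mu (x 0%N) * \prod_(i < n) semigroup G (t i.+1 - t i) (x i) (x i.+1))%:E
}.

Section Hitting.
Context {G : T -> T -> R} {mu : T -> R} (X : markov_chain G mu).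

Definition hitting_time (A : {set T}) (w : mc_space X) : \bar R :=
  ereal_inf [set t%:E | t in [set t : R | 0 <= t /\ mc_proc t w \in A]].

Definition expected_hitting_time (A : {set T}) : \bar R :=
  (\int[mc_prob X]_w hitting_time A w)%E.

Definition hitting_laplace (lambda : R) (A : {set T}) : \bar R :=
  (\int[mc_prob X]_w expeR (- (lambda%:E * hitting_time A w)))%E.

End Hitting.

(* X x is the chain started at x. *)
Definition average_hitting_time G pi
    (X : forall x, markov_chain G (point_mass x)) : \bar R :=
  (\sum_x \sum_y
     expected_hitting_time (X x) [set y]%SET * (pi x)%:E * (pi y)%:E)%E.

End Generators.

Definition exponents (R : realType) : seq (\bar R) :=
  [:: -oo%E; (-1)%:E; 0%:E; 1%:E; 2%:E; +oo%E].

(* Main.v *)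
Require Import Defs.
From mathcomp Require Import all_boot all_order all_algebra.
From mathcomp Require Import all_classical all_reals all_analysis.
From mathcomp Require Import measurable_realfun ring lra.

Import Order.TTheory GRing.Theory Num.Theory.
Import numFieldNormedType.Exports.

(** Everything follows from one comparison.  Homogeneity of the power means
    makes every [P p] reversible for [pi], and their monotonicity in [p] makes
    the off-diagonal rates of [P p] increase along the list of exponents: the
    generators are increasing for the Peskun order [peskun_le].  Along that
    order the Dirichlet form [E (f, f) = <- G f, f>] increases
    ([energy_peskun]), and each quantity of the theorem is monotone in it.

    The spectral gap is an infimum of values of [E].  The asymptotic variance
    and the Laplace transform of a hitting time are governed by a linear
    equation [Q g = h] with [Q] symmetric and nonnegative for [pi], and the
    number of interest is [<h, g>], that is [<h, Q^-1 h>]; if [Q1 <= Q2] then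
    [Q2^-1 <= Q1^-1].  For the variance [Q] is [- G]
    ([asymptotic_variance_peskun]).  For the hitting time of [A] it is
    [lambda - G] on the functions that vanish on [A]
    ([hitting_equation_peskun]).

    The latter needs the probabilistic identity ([integral_absorption])
    [E_mu (1 - exp (- lambda tau_A)) = sum_x mu x * u x], where [u] vanishes on
    [A] and [lambda u - G u = lambda] off [A], for a process that is known only
    through right-continuity of its paths and its finite-dimensional laws.  The
    process is observed on a grid of mesh [d].  The law at time [i d] of the
    path killed on [A] is obtained by iterating [exp (d G)] restricted to the
    complement of [A] ([killed_law]), so that the discounted sum of the
    probabilities of survival telescopes along [u], up to an error of order [d]
    that is controlled by [exp (d G) = 1 + d G + o (d)]
    ([discounted_survival_approx]).  Along a single path the discounted sum of the indicators of survival tends to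
    [1 - exp (- lambda tau_A)] as the mesh tends to 0
    ([cvg_grid_absorption]), and dominated convergence concludes.

    Expected hitting times are the increasing limits of
    [2^k * E_mu (1 - exp (- tau_A / 2^k))] ([cvg_expected_hitting_time]), hence
    inherit the comparison; these limits are linear in the initial law, so the
    average hitting time is a combination of hitting times started from [pi]
    ([average_hitting_timeE]).

    When [L] is reversible every [P p] equals [L].  Two realizations of the
    same chain may still live on different probability spaces; their hitting
    quantities agree because the comparison applies in both directions. *)

Local Open Scope classical_set_scope.
Local Open Scope ring_scope.

(** * Power means *)

Section PowerMeans.
Context {R : realType}.
Implicit Types (p : \bar R) (a b c : R).

Lemma power_mean_ge0 p a b : 0 <= a -> 0 <= b -> 0 <= power_mean p a b.
Proof.
move=> a0 b0; case: p => [r| |] /=.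
- by case: ifP => _; [exact: sqrtr_ge0|case: ifP => // _; exact: powR_ge0].
- by rewrite le_max a0.
- by rewrite le_min a0 b0.
Qed.

Lemma power_meanC p a b : power_mean p a b = power_mean p b a.
Proof.
case: p => [r| |] /=; [|exact: maxC|exact: minC].
by rewrite [a * b]mulrC orbC [a `^ r + _]addrC.
Qed.

Lemma power_mean_id p a : 0 <= a -> power_mean p a a = a.
Proof.
move=> a0; case: p => [r| |] /=; [|exact: maxxx|exact: minxx].
have [_|r0] := eqVneq r 0; first by rewrite -expr2 sqrtr_sqr ger0_norm.
rewrite orbb; case: ifP => [/andP[_ /eqP->]//|_].
by rewrite -mulr2n -(mulr_natr (a `^ r)) mulfK ?pnatr_eq0// -powRrM mulfV// powRr1.
Qed.

Lemma power_meanZ p a b c : 0 < c -> 0 <= a -> 0 <= b ->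
  power_mean p (c * a) (c * b) = c * power_mean p a b.
Proof.
move=> c0 a0 b0; have c0' := ltW c0; case: p => [r| |] /=.
- have [_|r0] := eqVneq r 0.
    rewrite mulrACA sqrtrM ?mulr_ge0// -expr2 sqrtr_sqr ger0_norm//.
  have c_eq0 d : (c * d == 0) = (d == 0) by rewrite mulf_eq0 gt_eqF.
  rewrite (c_eq0 a) (c_eq0 b).
  case: (_ && _); first exact/esym/mulr0.
  rewrite (powRM _ c0' a0) (powRM _ c0' b0) -mulrDr -mulrA powRM ?powR_ge0//; last first.
    by rewrite divr_ge0// addr_ge0// powR_ge0.
  by rewrite -powRrM mulfV// powRr1.
- by rewrite maxr_pMr.
- by rewrite minr_pMr.
Qed.

(** The right-hand side is also the value 0 by continuity when [a] or [b]
    vanishes, including [a = b = 0] where it divides by 0. *)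
Lemma power_mean_harmonic a b : 0 <= a -> 0 <= b ->
  power_mean (-1)%:E a b = 2 * a * b / (a + b).
Proof.
move=> a0 b0 /=; rewrite oppr_eq0 oner_eq0 ltrN10/=.
have [->|an0] := eqVneq a 0; first by rewrite mulr0 !mul0r.
have [->|bn0] := eqVneq b 0; first by rewrite mulr0 mul0r.
have a1 : 0 < a by rewrite lt_neqAle eq_sym an0.
have b1 : 0 < b by rewrite lt_neqAle eq_sym bn0.
rewrite /= !powR_inv1// invrN1 powR_inv1; last first.
  by rewrite divr_ge0// addr_ge0// invr_ge0.
by field; rewrite an0 bn0 gt_eqF//= addr_gt0.
Qed.

Lemma power_mean_geometric a b : power_mean 0%:E a b = Num.sqrt (a * b).
Proof. by rewrite /= eqxx. Qed.

Lemma power_mean_arithmetic a b : 0 <= a -> 0 <= b ->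
  power_mean 1%:E a b = (a + b) / 2.
Proof.
move=> a0 b0 /=; rewrite oner_eq0 ltr10/= !powRr1// invr1 powRr1//.
by rewrite divr_ge0// addr_ge0.
Qed.

Lemma power_mean_quadratic a b : 0 <= a -> 0 <= b ->
  power_mean 2%:E a b = Num.sqrt ((a ^+ 2 + b ^+ 2) / 2).
Proof.
move=> a0 b0 /=; rewrite pnatr_eq0/= ltNge ler0n/= powR12_sqrt.
  by rewrite !powR_mulrn.
by rewrite divr_ge0// addr_ge0// powR_ge0.
Qed.

Lemma sorted_exponents {D : Type} (r : rel D) (F : \bar R -> D) :
  sorted r [seq F p | p <- exponents R] =
  [&& r (F -oo%E) (F (-1)%:E), r (F (-1)%:E) (F 0%:E), r (F 0%:E) (F 1%:E),
      r (F 1%:E) (F 2%:E) & r (F 2%:E) (F +oo%E)].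
Proof. by rewrite /= andbT. Qed.

(** Squaring away the roots leaves, at each step between two of the four middle
    means, a nonnegative multiple of [(a - b) ^+ 2]. *)
Lemma power_mean_sorted a b : 0 <= a -> 0 <= b ->
  sorted <=%O [seq power_mean p a b | p <- exponents R].
Proof.
move=> a0 b0.
rewrite sorted_exponents.
rewrite power_mean_harmonic// power_mean_geometric// power_mean_arithmetic//.
rewrite power_mean_quadratic// [power_mean -oo%E _ _]/= [power_mean +oo%E _ _]/=.
have h0 : 0 <= 2 * a * b / (a + b) by rewrite divr_ge0 ?mulr_ge0 ?addr_ge0.
have m0 : 0 <= (a + b) / 2 by rewrite divr_ge0 ?addr_ge0.
have [s0|s0] := eqVneq (a + b) 0.
  have -> : a = 0 by lra.
  have -> : b = 0 by lra.
  by rewrite !(mulr0, mul0r, addr0, expr0n, minxx, maxxx, sqrtr0)/= !lexx.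
have s1 : 0 < a + b by rewrite lt_neqAle eq_sym s0 addr_ge0.
apply/and5P; split.
- rewrite ler_pdivlMr//; case: (leP a b) => ab; nra.
- rewrite -[leLHS]ger0_norm// -sqrtr_sqr ler_sqrt ?mulr_ge0//.
  rewrite expr_div_n ler_pdivrMr ?exprn_gt0//.
  rewrite -subr_ge0.
  have -> : a * b * (a + b) ^+ 2 - (2 * a * b) ^+ 2 = (a * b) * (a - b) ^+ 2 by ring.
  by apply: mulr_ge0; [exact: mulr_ge0|exact: sqr_ge0].
- rewrite -[leRHS]ger0_norm// -[leRHS]sqrtr_sqr ler_sqrt ?sqr_ge0//.
  have := sqr_ge0 (a - b); rewrite !expr2; nra.
- rewrite -[leLHS]ger0_norm// -sqrtr_sqr ler_sqrt.
    have := sqr_ge0 (a - b); rewrite !expr2; nra.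
  by rewrite divr_ge0 ?addr_ge0 ?exprn_ge0.
- have M0 : 0 <= Num.max a b by rewrite le_max a0.
  rewrite -[leRHS]ger0_norm// -[leRHS]sqrtr_sqr ler_sqrt ?sqr_ge0//.
  case: (leP a b) => ab; rewrite !expr2; nra.
Qed.

End PowerMeans.

(** * Power mean reversiblizations *)

Section Peskun.
Context {R : realType} {T : finType}.
Implicit Types (pi f g h u v : T -> R) (K L M G : T -> T -> R).

Definition peskun_le G1 G2 := forall x y, x != y -> G1 x y <= G2 x y.

Lemma with_zero_row_sums_sum0 K x :
  \sum_y with_zero_row_sums K x y = 0.
Proof.
rewrite (bigD1 x)//= {1}/with_zero_row_sums eqxx addrC; apply/eqP.
rewrite subr_eq0; apply/eqP/eq_bigr => y yx.
by rewrite /with_zero_row_sums eq_sym (negbTE yx).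
Qed.

Lemma with_zero_row_sums_id L : is_generator L -> with_zero_row_sums L = L.
Proof.
move=> [_ L0]; apply/funext => x; apply/funext => y.
rewrite /with_zero_row_sums; case: eqVneq => // <-.
apply/eqP; rewrite eq_sym -addr_eq0; apply/eqP.
by rewrite -[RHS](L0 x) [RHS](bigD1 x).
Qed.

Lemma dual_offdiag pi L x y : x != y -> dual pi L x y = pi y / pi x * L y x.
Proof. by move=> xy; rewrite /dual /with_zero_row_sums (negbTE xy). Qed.

Lemma dual_reversible pi L : (forall x, 0 < pi x) ->
  is_reversible_generator pi L -> dual pi L = L.
Proof.
move=> pi0 [Lg Lr]; rewrite -[RHS]with_zero_row_sums_id// /dual.
congr with_zero_row_sums; apply/funext => x; apply/funext => y.
by rewrite mulrAC -Lr mulrC mulKf// gt_eqF.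
Qed.

Section Reversiblization.
Variables (pi : T -> R) (L : T -> T -> R).
Hypotheses (pi_gt0 : forall x, 0 < pi x) (L_gen : is_generator L).
Let P := power_mean_reversiblization pi L.

Lemma dual_ge0 x y : x != y -> 0 <= dual pi L x y.
Proof.
move=> xy; rewrite dual_offdiag// mulr_ge0 ?divr_ge0 ?(ltW (pi_gt0 _))//.
by apply: L_gen.1; rewrite eq_sym.
Qed.

Lemma reversiblization_offdiag p x y : x != y ->
  P p x y = power_mean p (L x y) (dual pi L x y).
Proof.
by move=> xy; rewrite /P /power_mean_reversiblization /with_zero_row_sums
  (negbTE xy).
Qed.

(** Homogeneity turns [pi x * P p x y] into the mean of the two flows
    [pi x * L x y] and [pi y * L y x], which is symmetric in [x] and [y]. *)
Lemma reversiblization_reversible p : is_reversible_generator pi (P p).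
Proof.
have flow x y : x != y ->
    pi x * P p x y = power_mean p (pi x * L x y) (pi y * L y x).
  move=> xy; rewrite reversiblization_offdiag// dual_offdiag//.
  rewrite -power_meanZ//.
  - by congr power_mean; rewrite mulrA mulrCA mulfV ?mulr1// gt_eqF.
  - exact: L_gen.1.
  - by rewrite -dual_offdiag//; exact: dual_ge0.
split; first split.
- move=> x y xy; rewrite reversiblization_offdiag//.
  by apply: power_mean_ge0; [exact: L_gen.1|exact: dual_ge0].
- exact: with_zero_row_sums_sum0.
- move=> x y; have [->//|xy] := eqVneq x y.
  by rewrite (flow x y)// (flow y x) 1?eq_sym// power_meanC.
Qed.

Lemma reversiblization_sorted (x y : T) : x != y ->
  sorted <=%O [seq P p x y | p <- exponents R].
Proof.
move=> xy; have := @power_mean_sorted R (L x y) (dual pi L x y).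
move=> /(_ (L_gen.1 _ _ xy) (dual_ge0 _ _ xy)).
by under eq_map do rewrite -reversiblization_offdiag//.
Qed.

Lemma reversiblization_id p : is_reversible_generator pi L -> P p = L.
Proof.
move=> Lr; rewrite -[RHS](with_zero_row_sums_id _ L_gen).
rewrite /P /power_mean_reversiblization dual_reversible//.
apply/funext => x; apply/funext => y; rewrite /with_zero_row_sums.
case: eqVneq => xy; last by rewrite power_mean_id//; exact: L_gen.1.
congr -%R; apply: eq_bigr => z zx; rewrite power_mean_id//.
by apply: L_gen.1; rewrite eq_sym.
Qed.

End Reversiblization.

End Peskun.

(** * The Dirichlet form *)

Section Energy.
Context {R : realType} {T : finType}.
Implicit Types (pi f g h u v : T -> R) (K L M G : T -> T -> R).

Definition energy pi G f g := - \sum_x pi x * f x * apply_gen G g x.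

Lemma apply_genB G f g x :
  apply_gen G (fun y => f y - g y) x = apply_gen G f x - apply_gen G g x.
Proof. by rewrite /apply_gen -sumrB; apply: eq_bigr => y _; rewrite mulrBr. Qed.

Lemma energyBl pi G f g k :
  energy pi G (fun x => f x - g x) k = energy pi G f k - energy pi G g k.
Proof.
rewrite /energy -opprD -sumrB; congr -%R; apply: eq_bigr => x _; ring.
Qed.

Lemma energyBr pi G f g k :
  energy pi G f (fun x => g x - k x) = energy pi G f g - energy pi G f k.
Proof.
rewrite /energy -opprD -sumrB; congr -%R; apply: eq_bigr => x _.
by rewrite apply_genB mulrBr.
Qed.

Lemma energyC pi G f g : is_reversible_generator pi G ->
  energy pi G f g = energy pi G g f.
Proof.
move=> [_ Gr]; rewrite /energy /apply_gen; congr -%R.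
under eq_bigr do rewrite mulr_sumr; rewrite exchange_big/=.
apply: eq_bigr => x _; rewrite mulr_sumr; apply: eq_bigr => y _.
have := Gr x y; set a := G x y; set b := G y x => E.
have -> : pi y * f y * (b * g x) = (pi y * b) * f y * g x by ring.
by rewrite -E; ring.
Qed.

(** The diagonal of [G] multiplies a vanishing square, so the energy is a
    combination of the off-diagonal rates with nonnegative coefficients: this
    is what makes it monotone for the Peskun order. *)
Lemma energy_dirichlet pi G f : is_reversible_generator pi G ->
  energy pi G f f = (\sum_x \sum_y pi x * G x y * (f x - f y) ^+ 2) / 2.
Proof.
move=> [[_ G0] Gr].
have -> : \sum_x \sum_y pi x * G x y * (f x - f y) ^+ 2 =
    \sum_x \sum_y pi x * G x y * f x ^+ 2
    + \sum_x \sum_y pi x * G x y * f y ^+ 2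
    - 2 * (\sum_x pi x * f x * apply_gen G f x).
  rewrite mulr_sumr -big_split/= -sumrB; apply: eq_bigr => x _.
  rewrite /apply_gen !mulr_sumr -big_split/= -sumrB; apply: eq_bigr => y _; ring.
have row0 : \sum_x \sum_y pi x * G x y * f x ^+ 2 = 0.
  apply: big1 => x _; under eq_bigr do rewrite mulrAC.
  by rewrite -mulr_sumr G0 mulr0.
rewrite [X in _ + X - _]exchange_big/=.
under [X in _ + X - _]eq_bigr do under eq_bigr do rewrite Gr.
by rewrite row0 !add0r /energy mulNr mulrC mulKf.
Qed.

Lemma energy_ge0 pi G f : (forall x, 0 < pi x) ->
  is_reversible_generator pi G -> 0 <= energy pi G f f.
Proof.
move=> pi0 Gr; rewrite energy_dirichlet// divr_ge0//.
apply: sumr_ge0 => x _; apply: sumr_ge0 => y _.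
have [->|xy] := eqVneq x y; first by rewrite subrr expr0n mulr0.
by rewrite mulr_ge0 ?sqr_ge0// mulr_ge0 ?(ltW (pi0 _))//; exact: Gr.1.1.
Qed.

Lemma energy_peskun pi G1 G2 f : (forall x, 0 < pi x) ->
  is_reversible_generator pi G1 -> is_reversible_generator pi G2 ->
  peskun_le G1 G2 -> energy pi G1 f f <= energy pi G2 f f.
Proof.
move=> pi0 G1r G2r G12; rewrite !energy_dirichlet// ler_pM2r ?invr_gt0//.
apply: ler_sum => x _; apply: ler_sum => y _.
have [->|xy] := eqVneq x y; first by rewrite subrr expr0n !mulr0.
by rewrite ler_wpM2r ?sqr_ge0// ler_pM2l// G12.
Qed.

(** * Spectral gap, relaxation time and asymptotic variance *)

Lemma dot_energy pi G f :
  dot pi (fun x => - apply_gen G f x) f = energy pi G f f.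
Proof.
by rewrite /dot /energy -sumrN; apply: eq_bigr => x _; ring.
Qed.

Lemma spectral_gap_ge0 pi G : (forall x, 0 < pi x) ->
  is_reversible_generator pi G -> (0 <= spectral_gap G pi)%E.
Proof.
move=> pi0 Gr; apply: le_ereal_inf_tmp => _ [f _ <-].
by rewrite lee_fin dot_energy energy_ge0.
Qed.

Lemma spectral_gap_peskun pi G1 G2 : (forall x, 0 < pi x) ->
  is_reversible_generator pi G1 -> is_reversible_generator pi G2 ->
  peskun_le G1 G2 -> (spectral_gap G1 pi <= spectral_gap G2 pi)%E.
Proof.
move=> pi0 G1r G2r G12; apply: le_ereal_inf_tmp => _ [f fP <-].
apply: (@le_trans _ _ (dot pi (fun x => - apply_gen G1 f x) f)%:E).
  by apply: ereal_inf_lbound; exists f.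
by rewrite lee_fin !dot_energy energy_peskun.
Qed.

Lemma relaxation_time_peskun pi G1 G2 : (forall x, 0 < pi x) ->
  is_reversible_generator pi G1 -> is_reversible_generator pi G2 ->
  peskun_le G1 G2 -> (relaxation_time G2 pi <= relaxation_time G1 pi)%E.
Proof.
move=> pi0 G1r G2r G12; rewrite /relaxation_time.
by rewrite lee_pV2 ?inE ?spectral_gap_ge0// spectral_gap_peskun.
Qed.

(** For a symmetric matrix the image is the orthogonal of the kernel, so a
    larger kernel means a smaller image. *)
Lemma symmetric_image K1 K2 :
  (forall x y, K1 x y = K1 y x) -> (forall x y, K2 x y = K2 y x) ->
  (forall v, (forall x, apply_gen K2 v x = 0) -> forall x, apply_gen K1 v x = 0) ->
  forall f, exists g, forall x, apply_gen K2 g x = apply_gen K1 f x.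
Proof.
move=> K1C K2C kerK f.
pose M K : 'M[R]_#|T| := \matrix_(i, j) K (enum_val i) (enum_val j).
have MT K : (forall x y, K x y = K y x) -> (M K)^T = M K.
  by move=> KC; apply/matrixP => i j; rewrite !mxE KC.
have applyM K (v : 'cV_#|T|) i :
    (M K *m v) i 0 = apply_gen K (fun y => v (enum_rank y) 0) (enum_val i).
  rewrite mxE /apply_gen [RHS](reindex (fun j : 'I_#|T| => enum_val j))/=; last first.
    by apply: onW_bij; exact: enum_val_bij.
  by apply: eq_bigr => j _; rewrite !mxE enum_valK.
have sub : (M K1 <= M K2)%MS.
  rewrite submxE; apply/eqP/matrixP => i j; rewrite [RHS]mxE.
  pose v := col j (cokermx (M K2)).
  have colM (K : 'M[R]_#|T|) : K *m v = col j (K *m cokermx (M K2)).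
    by rewrite /v !colE mulmxA.
  have M2v i' : (M K2 *m v) i' 0 = 0.
    by rewrite colM mulmx_coker !mxE.
  have -> : (M K1 *m cokermx (M K2)) i j = (M K1 *m v) i 0.
    by rewrite colM [RHS]mxE.
  rewrite applyM; apply: kerK => x.
  by rewrite -[x]enum_rankK -applyM M2v.
have [D MD] := submxP sub.
pose v := D^T *m (\col_i f (enum_val i)).
exists (fun y => v (enum_rank y) 0) => x.
rewrite -{1}[x]enum_rankK -applyM /v mulmxA -{1}(MT _ K2C) -trmx_mul -MD MT//.
rewrite applyM enum_rankK; apply: eq_bigr => y _.
by rewrite mxE enum_rankK.
Qed.

(** Zero energy forces [f] to be constant along every edge with a positive
    rate. *)
Lemma energy_eq0 pi G f : (forall x, 0 < pi x) -> is_reversible_generator pi G ->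
  energy pi G f f = 0 -> forall x, apply_gen G f x = 0.
Proof.
move=> pi0 Gr; rewrite energy_dirichlet// => E0 x.
have term_ge0 x' y : 0 <= pi x' * G x' y * (f x' - f y) ^+ 2.
  have [->|xy] := eqVneq x' y; first by rewrite subrr expr0n mulr0.
  by rewrite mulr_ge0 ?sqr_ge0// mulr_ge0 ?(ltW (pi0 _))//; exact: Gr.1.1.
have /eqP := E0; rewrite mulf_eq0 invr_eq0 pnatr_eq0 orbF.
rewrite psumr_eq0 => [/allP/(_ x (mem_index_enum _))/=|x' _]; last first.
  by apply: sumr_ge0 => y _.
rewrite psumr_eq0// => /allP row0.
rewrite /apply_gen (eq_bigr (fun y => G x y * f x)) => [|y _].
  by rewrite -mulr_suml Gr.1.2 mul0r.
have := row0 y (mem_index_enum _); rewrite /= mulf_eq0 mulf_eq0 (gt_eqF (pi0 _))/=.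
case/orP => [/eqP->|]; first by rewrite !mul0r.
by rewrite sqrf_eq0 subr_eq0 => /eqP->.
Qed.

Lemma kernel_peskun pi G1 G2 : (forall x, 0 < pi x) ->
  is_reversible_generator pi G1 -> is_reversible_generator pi G2 ->
  peskun_le G1 G2 -> forall v, (forall x, apply_gen G2 v x = 0) ->
  forall x, apply_gen G1 v x = 0.
Proof.
move=> pi0 G1r G2r G12 v G2v; apply: (energy_eq0 pi) => //.
apply/eqP; rewrite eq_le energy_ge0// andbT.
apply: le_trans (energy_peskun _ _ _ v pi0 G1r G2r G12) _.
by rewrite /energy big1 ?oppr0// => x _; rewrite G2v mulr0.
Qed.

(** Solvability of the Poisson equation passes from [G1] to [G2]: a reducible
    generator can only lose invariant functions when rates are increased.
    Multiplying by [pi] turns the generators into symmetric matrices. *)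
Lemma image_peskun pi G1 G2 : (forall x, 0 < pi x) ->
  is_reversible_generator pi G1 -> is_reversible_generator pi G2 ->
  peskun_le G1 G2 -> forall f, exists g, apply_gen G2 g = apply_gen G1 f.
Proof.
move=> pi0 G1r G2r G12 f.
pose K G x y := pi x * G x y.
have KE G v x : apply_gen (K G) v x = pi x * apply_gen G v x.
  by rewrite /apply_gen mulr_sumr; apply: eq_bigr => y _; rewrite /K mulrA.
have [|||g Hg] := symmetric_image (K G1) (K G2) _ _ _ f.
- by move=> x y; exact: G1r.2.
- by move=> x y; exact: G2r.2.
- move=> v K2v x; rewrite KE (kernel_peskun pi G1 G2)// ?mulr0// => y.
  by move/eqP: (K2v y); rewrite KE mulf_eq0 (gt_eqF (pi0 _)) => /eqP.
exists g; apply/funext => x; apply: (mulfI (lt0r_neq0 (pi0 x))).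
by rewrite -!KE.
Qed.

(** With [h = G1 g1 = G2 g2] one has [- <h, g1> = E1 (g1, g1)] and
    [- <h, g2> = E2 (g2, g2) = E1 (g1, g2)], and the claim is what is left of
    [0 <= E1 (g1 - g2, g1 - g2)] after bounding [E1 (g2, g2)] by
    [E2 (g2, g2)]. *)
Lemma asymptotic_variance_peskun pi G1 G2 h : (forall x, 0 < pi x) ->
  is_reversible_generator pi G1 -> is_reversible_generator pi G2 ->
  peskun_le G1 G2 ->
  (asymptotic_variance h G2 pi <= asymptotic_variance h G1 pi)%E.
Proof.
move=> pi0 G1r G2r G12; rewrite /asymptotic_variance.
case: pselect => [ex2|no2]; case: pselect => [ex1|_]; rewrite ?leey//; last first.
  case: ex1 => g1 g1h; case: no2.
  by have [g Hg] := image_peskun pi G1 G2 pi0 G1r G2r G12 g1; exists g; rewrite Hg.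
case: (cid ex2) => g2 /= H2; case: (cid ex1) => g1 /= H1.
have dotE G f g : apply_gen G g = h -> - dot pi h f = energy pi G f g.
  by move=> <-; rewrite /dot /energy; congr -%R; apply: eq_bigr => x _; ring.
rewrite lee_fin !mulNr -!mulrN (dotE G1 g1 g1)// ler_pM2l//.
rewrite (dotE G2 g2 g2)//.
have := energy_ge0 _ _ (fun x => g1 x - g2 x) pi0 G1r.
rewrite energyBl !energyBr (energyC _ _ g1 g2)//.
have -> : energy pi G1 g2 g1 = energy pi G2 g2 g2.
  by rewrite -(dotE G1 g2 g1)// (dotE G2 g2 g2).
have := energy_peskun _ _ _ g2 pi0 G1r G2r G12; lra.
Qed.

End Energy.

(** * The semigroup at small times *)

Section Semigroup.
Context {R : realType} {T : finType}.
Variable G : T -> T -> R.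

(** A crude bound for the norm of [G], sufficient for the second-order estimate
    of the semigroup. *)
Definition total_rate : R := \sum_x \sum_y `|G x y|.

Lemma total_rate_ge0 : 0 <= total_rate.
Proof. by apply: sumr_ge0 => x _; apply: sumr_ge0. Qed.

Lemma norm_gen_pow_le k x y : `|gen_pow G k x y| <= total_rate ^+ k.
Proof.
elim: k x => [|k IH] x /=; first by case: (x == y); rewrite ?normr1 ?normr0.
apply: le_trans (ler_norm_sum _ _ _) _.
apply: (@le_trans _ _ (\sum_z `|G x z| * total_rate ^+ k)).
  by apply: ler_sum => z _; rewrite normrM ler_wpM2l.
rewrite -mulr_suml exprS ler_wpM2r ?exprn_ge0 ?total_rate_ge0//.
rewrite /total_rate [leRHS](bigD1 x)//= lerDl.
by apply: sumr_ge0 => z _; apply: sumr_ge0.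
Qed.

(** The coefficients of the series of [exp (t G)] are dominated by those of
    the scalar exponential series of [t * total_rate], so its tail from degree 2
    on is dominated by the scalar tail. *)
Lemma semigroup_expansion t x y : 0 <= t ->
  `|semigroup G t x y - (x == y)%:R - t * G x y|
    <= expR (t * total_rate) - 1 - t * total_rate.
Proof.
move=> t0; set C := total_rate.
pose c k := t ^+ k / k`!%:R * gen_pow G k x y.
pose b := exp_coeff (t * C).
have cb k : `|c k| <= b k.
  rewrite /c /b /exp_coeff/= normrM ger0_norm ?divr_ge0 ?exprn_ge0//.
  rewrite exprMn mulrAC ler_wpM2r ?invr_ge0//.
  by rewrite ler_wpM2l ?exprn_ge0// norm_gen_pow_le.
have b_cvg : series b @ \oo --> expR (t * C) by exact: is_cvg_series_exp_coeff.
have c_cvg : series c @ \oo --> semigroup G t x y.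
  suff : cvgn (series c) by [].
  apply: normed_cvg; apply: (series_le_cvg _ _ cb); last exact: cvgP b_cvg.
    by [].
  by move=> k; exact: le_trans (normr_ge0 _) (cb k).
have c0 : c 0%N = (x == y)%:R by rewrite /c expr0 fact0 invr1 !mul1r.
have c1 : c 1%N = t * G x y.
  rewrite /c expr1 (factS 0) fact0 muln1 divr1 /= (bigD1 y)//= eqxx mulr1 big1 ?addr0//.
  by move=> z /negbTE->; rewrite mulr0.
have b0 : b 0%N = 1 by rewrite /b /exp_coeff/= expr0 fact0 invr1 mulr1.
have b1 : b 1%N = t * C by rewrite /b /exp_coeff/= expr1 (factS 0) fact0 muln1 divr1.
rewrite -c0 -c1 -b0 -[X in _ <= _ - X]b1.
have c_lim : `|series c n - c 0%N - c 1%N| @[n --> \oo] -->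
    `|semigroup G t x y - c 0%N - c 1%N|.
  by apply: cvg_norm; apply: cvgB (cvg_cst _); apply: cvgB (cvg_cst _).
have b_lim : series b n - b 0%N - b 1%N @[n --> \oo] -->
    expR (t * C) - b 0%N - b 1%N.
  by apply: cvgB (cvg_cst _); apply: cvgB (cvg_cst _).
apply: (ler_cvg_to c_lim b_lim).
near=> n.
have n2 : (2 <= n)%N by near: n; exists 2%N.
have tail (f : nat -> R) : series f n - f 0%N - f 1%N = \sum_(2 <= k < n) f k.
  rewrite /series/= big_ltn ?(leq_trans _ n2)// big_ltn//.
  by ring.
rewrite !tail; apply: le_trans (ler_norm_sum _ _ _) _.
by apply: ler_sum => k _; exact: cb.
Unshelve. all: by end_near. Qed.

End Semigroup.

(** * Survival on a grid *)

Section Grid.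
Context {R : realType} {T : finType} {G : T -> T -> R} {mu : T -> R}.
Variables (X : markov_chain G mu) (A : {set T}) (d : R).
Hypothesis d_ge0 : 0 <= d.

(** The mass at [y], at time [i * d], of the paths that avoided [A] at the
    grid times strictly before [i * d]; time [i * d] itself is not tested, which
    makes the recursion start at [mu]. *)
Fixpoint killed_law i : T -> R := if i is j.+1
  then fun y => \sum_(z | z \notin A) killed_law j z * semigroup G d z y
  else mu.

Definition grid_survival i : set (mc_space X) :=
  [set w | forall j, (j <= i)%N -> mc_proc (j%:R * d) w \notin A].

(** These events interpolate between the cylinders, of known probability
    ([m = 0]), and the events measured by [killed_law n] ([m = n]): raising [m]
    by one sums over the states off [A] at time [m * d]. *)
Let partial_cylinder m n (x : nat -> T) : set (mc_space X) :=
  [set w | (forall j, (j < m)%N -> mc_proc (j%:R * d) w \notin A) /\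
           (forall j, (m <= j <= n)%N -> mc_proc (j%:R * d) w = x j)].

Lemma measurable_grid_event (Q : nat -> T -> Prop) :
  measurable [set w : mc_space X | forall j, Q j (mc_proc (j%:R * d) w)].
Proof.
have -> : [set w : mc_space X | forall j, Q j (mc_proc (j%:R * d) w)] =
    \bigcap_j \bigcup_(z in Q j) [set w | mc_proc (j%:R * d) w = z].
  apply/seteqP; split => [w H j _|w H j]; first by exists (mc_proc (j%:R * d) w).
  by have [z Qz /= ->] := H j I.
apply: bigcapT_measurable => j; apply: fin_bigcup_measurable => // z _.
by apply: mc_measurable; rewrite mulr_ge0.
Qed.

Lemma measurable_partial_cylinder m n x : measurable (partial_cylinder m n x).
Proof.
apply: measurableI.
  exact: (measurable_grid_event (fun j z => (j < m)%N -> z \notin A)).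
exact: (measurable_grid_event (fun j z => (m <= j <= n)%N -> z = x j)).
Qed.

Lemma measurable_grid_survival i : measurable (grid_survival i).
Proof.
exact: (measurable_grid_event (fun j z => (j <= i)%N -> z \notin A)).
Qed.

Lemma partial_cylinderE m n x : (m <= n)%N ->
  mc_prob X (partial_cylinder m n x) =
  (killed_law m (x m)
   * \prod_(m <= j < n) semigroup G d (x j) (x j.+1))%:E.
Proof.
elim: m x => [|m IH] x mn.
  have := @mc_finite_dimensional _ _ _ _ X n (fun i => i%:R * d) x.
  rewrite mul0r => /(_ erefl) fdd.
  rewrite (_ : partial_cylinder 0 n x =
    [set w | forall i, (i <= n)%N -> mc_proc (i%:R * d) w = x i]); last first.
    by apply/seteqP; split => w /= => [[_ H] i ? //|H]; [exact: H|split].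
  rewrite fdd => [|i]; last by rewrite ler_wpM2r// ler_nat.
  rewrite big_mkord; congr (_ * _)%:E; apply: eq_bigr => i _.
  by rewrite -mulrBl -natrB// subSnn mul1r.
pose x' z := fun j => if j == m then z else x j.
have -> : partial_cylinder m.+1 n x =
    \bigcup_(z in [set` [pred z | z \notin A]]) partial_cylinder m n (x' z).
  apply/seteqP; split => [w /= [H1 H2]|w [z /= zA [H1 H2]]].
    exists (mc_proc (m%:R * d) w); first exact: H1.
    split=> j jm; first by apply: H1; rewrite ltnW.
    rewrite /x'; case: eqVneq => [->//|jm'].
    by apply: H2; rewrite ltn_neqAle eq_sym jm'.
  split=> j jm.
    move: jm; rewrite ltnS leq_eqVlt => /orP[/eqP->|]; last exact: H1.
    by rewrite H2 ?leqnn ?(ltnW mn)// /x' eqxx.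
  case/andP: jm => mj jn; rewrite H2 ?jn ?(ltnW mj)// /x'.
  by rewrite gtn_eqF.
rewrite measure_fin_bigcup; last 3 first.
- exact: finite_finset.
- move=> z1 z2 _ _ [w [/= [_ /(_ m)]]]; rewrite leqnn (ltnW mn) /x' eqxx => <-//.
  by move=> [_ /(_ m)]; rewrite leqnn (ltnW mn) eqxx => ->.
- by move=> z _; exact: measurable_partial_cylinder.
rewrite -(@bigfs _ _ _ _ (index_enum T))/=; last 2 first.
- exact: index_enum_uniq.
- by move=> z _; rewrite mem_index_enum.
rewrite /= mulr_suml -sumEFin; apply: eq_bigr => z _; rewrite IH ?(ltnW mn)//.
congr (_%:E); rewrite big_ltn// mulrA /x' eqxx gtn_eqF//; congr (_ * _).
rewrite [LHS]big_nat [RHS]big_nat; apply: eq_bigr => j /andP[mj _].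
by rewrite !gtn_eqF// ltnW.
Qed.

(** The series of [exp (d G)] has terms of both signs; the sign of [killed_law]
    is that of the probability of an event. *)
Lemma killed_law_ge0 i y : 0 <= killed_law i y.
Proof.
rewrite -lee_fin.
have -> : (killed_law i y)%:E = mc_prob X (partial_cylinder i i (fun=> y)).
  by rewrite partial_cylinderE// big_geq// mulr1.
exact: measure_ge0.
Qed.

Lemma grid_survivalE i :
  mc_prob X (grid_survival i) = (\sum_(y | y \notin A) killed_law i y)%:E.
Proof.
have -> : grid_survival i = 
    \bigcup_(y in [set` [pred y | y \notin A]]) partial_cylinder i i (fun=> y).
  apply/seteqP; split => [w /= H|w [y /= yA [H1 H2]]].
    exists (mc_proc (i%:R * d) w); first exact: H.
    split=> j; first by move=> ji; apply: H; exact: ltnW.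
    by rewrite -eqn_leq => /eqP->.
  move=> j; rewrite leq_eqVlt => /orP[/eqP->|]; last exact: H1.
  by rewrite H2 ?leqnn.
rewrite measure_fin_bigcup; last 3 first.
- exact: finite_finset.
- move=> z1 z2 _ _ [w [/= [_ /(_ i)]]]; rewrite leqnn => <-//.
  by move=> [_ /(_ i)]; rewrite leqnn => ->.
- by move=> z _; exact: measurable_partial_cylinder.
rewrite -(@bigfs _ _ _ _ (index_enum T))/=; last 2 first.
- exact: index_enum_uniq.
- by move=> z _; rewrite mem_index_enum.
rewrite -sumEFin; apply: eq_bigr => z _.
by rewrite partial_cylinderE// big_geq// mulr1.
Qed.

Lemma killed_law_sum_le1 i : \sum_(y | y \notin A) killed_law i y <= 1.
Proof.
rewrite -lee_fin -grid_survivalE; apply: probability_le1.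
exact: measurable_grid_survival.
Qed.

End Grid.

(** * The discounted probability of survival *)

Lemma geometric_sum {R : realType} (r : R) n :
  (1 - r) * \sum_(0 <= i < n) r ^+ i = 1 - r ^+ n.
Proof.
elim: n => [|n IH]; first by rewrite big_geq// mulr0 expr0 subrr.
by rewrite big_nat_recr//= mulrDr IH exprS; ring.
Qed.

(** The solution is the function [x |-> E_x (1 - exp (- lambda tau_A))]. *)
Definition hitting_equation {R : realType} {T : finType} (G : T -> T -> R)
    (lambda : R) (A : {set T}) (u : T -> R) :=
  (forall x, x \in A -> u x = 0) /\
  (forall x, x \notin A -> lambda * u x - apply_gen G u x = lambda).

Section Telescope.
Context {R : realType} {T : finType} {G : T -> T -> R} {mu : T -> R}.
Variables (X : markov_chain G mu) (A : {set T}) (lambda : R) (u : T -> R).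
Hypotheses (lambda_gt0 : 0 < lambda) (uP : hitting_equation G lambda A u).

Let U := \sum_x `|u x|.

Let norm_u_le x : `|u x| <= U.
Proof. by rewrite /U (bigD1 x)//= lerDl sumr_ge0. Qed.

Section Step.
Variable d : R.
Hypothesis d_gt0 : 0 < d.
Let r := expR (- (lambda * d)).
Let S := semigroup G d.
Let s i (v : T -> R) :=
  \sum_(y | y \notin A) killed_law (G := G) (mu := mu) A d i y * v y.

(** The failure of [u] to solve the discrete-time analogue
    [(1 - r) + r S u = u] of the hitting equation. *)
Definition one_step_defect z := 1 - r - u z + r * \sum_y S z y * u y.

Lemma killed_law_next i : s i.+1 u = s i (fun z => \sum_y S z y * u y).
Proof.
rewrite /s /= [RHS](eq_bigr (fun z => \sum_(y | y \notin A)
    killed_law (G := G) (mu := mu) A d i z * S z y * u y)); last first.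
  move=> z zA; rewrite (bigID (fun y => y \in A))/= big1 ?add0r; last first.
    by move=> y yA; rewrite uP.1// mulr0.
  by rewrite mulr_sumr; apply: eq_bigr => y yA; rewrite mulrA.
rewrite [RHS]exchange_big/=; apply: eq_bigr => y yA.
by rewrite mulr_suml.
Qed.

(** The masses [r ^+ i * s i u] telescope, each step contributing the
    probability of survival up to the defect. *)
Lemma killed_law_telescope n :
  (1 - r) * \sum_(0 <= i < n) r ^+ i * s i (fun=> 1) =
  s 0 u - r ^+ n * s n u + \sum_(0 <= i < n) r ^+ i * s i one_step_defect.
Proof.
elim: n => [|n IH]; first by rewrite !big_geq// expr0; ring.
rewrite !big_nat_recr//= mulrDr IH.
have -> : s n one_step_defect = (1 - r) * s n (fun=> 1) - s n u + r * s n.+1 u.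
  rewrite killed_law_next /s !mulr_sumr -sumrB -big_split/=.
  by apply: eq_bigr => y _; rewrite /one_step_defect; ring.
by rewrite exprS; ring.
Qed.

Definition step_error :=
  lambda * d * (1 + U)
  + U / lambda * ((expR (d * total_rate G) - 1 - d * total_rate G) / d).

Let r_bounds : [/\ 0 < r, r < 1, r * (1 + lambda * d) <= 1 & 1 - r <= lambda * d].
Proof.
have ld : 0 < lambda * d by rewrite mulr_gt0.
split; first exact: expR_gt0.
- by rewrite /r expR_lt1 oppr_lt0.
- have rV : r * expR (lambda * d) = 1 by rewrite /r -expRD addNr expR0.
  by rewrite -[leRHS]rV ler_pM2l ?expR_gt0// expR_ge1Dx.
- by have := expR_ge1Dx (- (lambda * d)); rewrite -/r; lra.
Qed.

(** Writing the one-step kernel as [1 + d G + o(d)], the first-order terms of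
    the defect cancel by the equation satisfied by [u]. *)
Lemma norm_one_step_defect_le z : z \notin A ->
  `|one_step_defect z| <= (1 - r) * step_error.
Proof.
move=> zA; have [r0 r1 rh1 rh2] := r_bounds.
pose C := total_rate G; pose eta := (expR (d * C) - 1 - d * C) / d.
have eta0 : 0 <= eta.
  rewrite divr_ge0 ?(ltW d_gt0)//; have := expR_ge1Dx (d * C); lra.
pose rho y := S z y - (z == y)%:R - d * G z y.
have rho_le y : `|rho y| <= d * eta.
  rewrite /eta mulrC divfK ?gt_eqF//.
  exact: semigroup_expansion (ltW d_gt0).
have Su : \sum_y S z y * u y = u z + d * (lambda * u z - lambda) + \sum_y rho y * u y.
  have -> : lambda * u z - lambda = apply_gen G u z.
    by have := uP.2 _ zA; lra.
  have -> : u z = \sum_y (z == y)%:R * u y.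
    rewrite (bigD1 z)//= eqxx mul1r big1 ?addr0// => y /negbTE.
    by rewrite eq_sym => ->; rewrite mul0r.
  rewrite /apply_gen mulr_sumr -!big_split/=; apply: eq_bigr => y _.
  by rewrite /rho; ring.
have rho_u : `|\sum_y rho y * u y| <= d * eta * U.
  apply: le_trans (ler_norm_sum _ _ _) _; rewrite /U mulr_sumr.
  by apply: ler_sum => y _; rewrite normrM ler_wpM2r.
have -> : one_step_defect z =
    (1 - r - r * (lambda * d)) * (1 - u z) + r * \sum_y rho y * u y.
  by rewrite /one_step_defect Su; ring.
have ld : 0 < lambda * d by rewrite mulr_gt0.
apply: le_trans (ler_normD _ _) _; rewrite /step_error [leRHS]mulrDr; apply: lerD.
- rewrite normrM [leRHS]mulrA ger0_norm; last lra.
  apply: ler_pM => //; [lra|nra|].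
  apply: le_trans (ler_normB _ _) _; rewrite normr1 lerD2l; exact: norm_u_le.
- rewrite normrM (gtr0_norm r0) -/C -/eta.
  apply: (@le_trans _ _ (r * (d * eta * U))); first by rewrite ler_pM2l.
  have -> : r * (d * eta * U) = r * (lambda * d) * (U / lambda * eta).
    by field; rewrite gt_eqF.
  rewrite ler_wpM2r//; last lra.
  by rewrite mulr_ge0// divr_ge0 ?(ltW lambda_gt0)// sumr_ge0.
Qed.

Lemma step_error_ge0 : 0 <= step_error.
Proof.
have U0 : 0 <= U by rewrite sumr_ge0.
rewrite addr_ge0//.
  by rewrite !mulr_ge0 ?addr_ge0 ?(ltW lambda_gt0) ?(ltW d_gt0).
apply: mulr_ge0; first by rewrite divr_ge0 ?(ltW lambda_gt0).
rewrite divr_ge0 ?(ltW d_gt0)//.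
by have := expR_ge1Dx (d * total_rate G); lra.
Qed.

(** The defects are of order [(1 - r) * step_error], and [(1 - r)] is absorbed
    by the geometric sum, which is why the number of steps does not enter the
    error. *)
Lemma discounted_survival_approx n :
  `|(1 - r) * \sum_(0 <= i < n) r ^+ i * s i (fun=> 1) - \sum_x mu x * u x|
    <= r ^+ n * U + step_error.
Proof.
have [r0 r1 _ _] := r_bounds.
have s_le v M i : 0 <= M -> (forall y, y \notin A -> `|v y| <= M) -> `|s i v| <= M.
  move=> M0 vM; apply: le_trans (ler_norm_sum _ _ _) _.
  apply: (@le_trans _ _ (\sum_(y | y \notin A)
      killed_law (G := G) (mu := mu) A d i y * M)).
    apply: ler_sum => y yA; rewrite normrM ger0_norm; last first.
      exact: (killed_law_ge0 X A d (ltW d_gt0)).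
    by apply: ler_wpM2l (vM _ yA); exact: (killed_law_ge0 X A d (ltW d_gt0)).
  rewrite -mulr_suml -[leRHS]mul1r ler_wpM2r//.
  exact: (killed_law_sum_le1 X A d (ltW d_gt0)).
have mu_u : \sum_x mu x * u x = s 0 u.
  rewrite (bigID (fun x => x \in A))/= big1 ?add0r// => x xA.
  by rewrite uP.1// mulr0.
rewrite killed_law_telescope mu_u.
set E := \sum_(0 <= i < n) _.
rewrite (_ : _ - s 0 u = E - r ^+ n * s n u); last by ring.
apply: le_trans (ler_normB _ _) _; rewrite addrC; apply: lerD.
  rewrite normrM ger0_norm ?exprn_ge0 ?(ltW r0)// ler_wpM2l ?exprn_ge0 ?(ltW r0)//.
  by apply: s_le => //; rewrite sumr_ge0.
apply: le_trans (ler_norm_sum _ _ _) _.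
apply: (@le_trans _ _ (\sum_(0 <= i < n) r ^+ i * ((1 - r) * step_error))).
  apply: ler_sum => i _; rewrite normrM ger0_norm ?exprn_ge0 ?(ltW r0)//.
  rewrite ler_wpM2l ?exprn_ge0 ?(ltW r0)//; apply: s_le.
    by rewrite mulr_ge0 ?step_error_ge0//; lra.
  exact: norm_one_step_defect_le.
rewrite -mulr_suml mulrA [_ * (1 - r)]mulrC geometric_sum.
by rewrite -[leRHS]mul1r ler_wpM2r ?step_error_ge0// gerBl exprn_ge0// ltW.
Qed.

End Step.

End Telescope.

(** * From the grid to the hitting time *)

Lemma expR_le_quadratic {R : realType} (x : R) : 0 <= x -> x <= 2^-1 ->
  expR x - 1 - x <= 2 * x ^+ 2.
Proof.
move=> x0 x1; have := expR_ge1Dx (- x); rewrite expRN => h.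
have e0 := expR_gt0 x.
have {}h : expR x * (1 - x) <= 1.
  by rewrite -[leRHS](mulfV (lt0r_neq0 e0)); rewrite ler_pM2l.
have {}h : expR x <= (1 - x)^-1 by rewrite -[leRHS]mul1r ler_pdivlMr//; lra.
suff : (1 - x)^-1 <= 1 + x + 2 * x ^+ 2 by lra.
rewrite -[leLHS]mul1r ler_pdivrMr; last lra.
nra.
Qed.

Section Limit.
Context {R : realType} {T : finType} {G : T -> T -> R} {mu : T -> R}.
Variables (X : markov_chain G mu) (A : {set T}) (lambda : R).
Hypothesis lambda_gt0 : 0 < lambda.

(** The mesh tends to 0 while the observed time span
    [mesh k * horizon k = k + 1] tends to infinity. *)
Let mesh k : R := k.+1%:R^-1.
Let horizon k : nat := (k.+1 * k.+1)%N.
Let r k := expR (- (lambda * mesh k)).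

Let mesh_gt0 k : 0 < mesh k. Proof. by rewrite invr_gt0. Qed.

Let cvg_mesh : mesh @ \oo --> 0. Proof. exact: cvg_harmonic. Qed.

Let r_gt0 k : 0 < r k. Proof. exact: expR_gt0. Qed.

Let r_lt1 k : r k < 1.
Proof. by rewrite expR_lt1 oppr_lt0 mulr_gt0. Qed.

Let cvg_r_horizon : r k ^+ horizon k @[k --> \oo] --> 0.
Proof.
have rE k : r k ^+ horizon k = expR (- lambda) ^+ k.+1.
  rewrite /r /horizon -expRM_natr -expRM_natr natrM /mesh; congr expR.
  by rewrite !mulNr -mulrA mulKf// pnatr_eq0.
under eq_cvg do rewrite rE.
have : `|expR (- lambda)| < 1 by rewrite gtr0_norm ?expR_gt0// expR_lt1 oppr_lt0.
by move=> /cvg_expr; rewrite -cvg_shiftS.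
Qed.

Lemma cvg_step_error (u : T -> R) :
  step_error (G := G) lambda u (mesh k) @[k --> \oo] --> 0.
Proof.
set U := \sum_x `|u x|; pose C := total_rate G.
pose K := lambda * (1 + U) + U / lambda * (2 * C ^+ 2).
have C0 : 0 <= C by exact: total_rate_ge0.
have U0 : 0 <= U by rewrite sumr_ge0.
have Km : K * mesh k @[k --> \oo] --> 0.
  by rewrite -[X in _ --> X](mulr0 K); apply: cvgM => //; exact: cvg_cst.
have Cm : C * mesh k @[k --> \oo] --> 0.
  by rewrite -[X in _ --> X](mulr0 C); apply: cvgM => //; exact: cvg_cst.
apply: squeeze_cvgr Km; last exact: cvg_cst.
near=> k; rewrite step_error_ge0//=.
have Ck : C * mesh k <= 2^-1.
  apply: ltW; near: k; apply: (cvgr_lt _ Cm); by rewrite invr_gt0.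
rewrite /step_error -/U -/C /K [leRHS]mulrDl; apply: lerD.
  by rewrite mulrAC.
rewrite -[leRHS]mulrA ler_wpM2l// ?divr_ge0 ?(ltW lambda_gt0)//.
rewrite ler_pdivrMr//.
have h := expR_le_quadratic (C * mesh k) (mulr_ge0 C0 (ltW (mesh_gt0 k))) Ck.
rewrite [mesh k * C]mulrC; apply: le_trans h _.
by rewrite exprMn; lra.
Unshelve. all: by end_near. Qed.

(** By summation of the geometric series this is [1 - r ^+ N], where [N] is the
    first grid index in [A], or the horizon if that comes first; as
    [r = exp (- lambda * mesh)], it discretizes [1 - exp (- lambda tau_A)]. *)
Definition grid_absorption k (w : mc_space X) : R :=
  (1 - r k) * \sum_(0 <= i < horizon k)
    r k ^+ i * \1_(grid_survival X A (mesh k) i) w.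

Let grid_absorption_ge0 k w : 0 <= grid_absorption k w.
Proof.
apply: mulr_ge0; first by rewrite subr_ge0 ltW.
by apply: sumr_ge0 => i _; rewrite mulr_ge0 ?exprn_ge0 ?(ltW (r_gt0 _)).
Qed.

Let indic_le1 (B : set (mc_space X)) w : \1_B w <= 1 :> R.
Proof. by rewrite indicE; case: (_ \in _). Qed.

Let grid_absorption_le k m w :
  (m <= horizon k)%N ->
  (forall i, (m <= i < horizon k)%N -> ~ grid_survival X A (mesh k) i w) ->
  grid_absorption k w <= 1 - r k ^+ m.
Proof.
move=> mh dead; rewrite -geometric_sum /grid_absorption ler_pM2l ?subr_gt0//.
rewrite [leLHS](big_cat_nat (n := m))//=.
rewrite [X in _ + X <= _]big_nat [X in _ + X <= _]big1 ?addr0 => [|i mi].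
  by apply: ler_sum => i _; rewrite -[leRHS]mulr1 ler_wpM2l ?exprn_ge0 ?(ltW (r_gt0 _)).
by rewrite indicE memNset ?mulr0//; exact: dead.
Qed.

Let grid_absorption_ge k m w :
  (m <= horizon k)%N ->
  (forall i, (i < m)%N -> grid_survival X A (mesh k) i w) ->
  1 - r k ^+ m <= grid_absorption k w.
Proof.
move=> mh alive; rewrite -geometric_sum /grid_absorption ler_pM2l ?subr_gt0//.
rewrite [leRHS](big_cat_nat (n := m))//= -[leLHS]addr0; apply: lerD.
  rewrite [leLHS]big_nat [leRHS]big_nat; apply: ler_sum => i /andP[_ im].
  by rewrite indicE mem_set ?mulr1//; exact: alive.
by apply: sumr_ge0 => i _; rewrite mulr_ge0 ?exprn_ge0 ?(ltW (r_gt0 _)).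
Qed.

(** Right-continuity for the discrete topology makes the infimum a minimum and
    keeps the path in [A] for a while afterwards, long enough for a fine grid to
    notice it. *)
Lemma hitting_timeP w :
  (hitting_time A w = +oo%E /\ forall t, 0 <= t -> mc_proc (m := X) t w \notin A) \/
  exists t0 e : R, [/\ 0 <= t0, 0 < e, hitting_time A w = t0%:E,
    forall t, 0 <= t -> t < t0 -> mc_proc (m := X) t w \notin A &
    forall t, t0 <= t -> t < t0 + e -> mc_proc (m := X) t w \in A].
Proof.
pose E := [set t : R | 0 <= t /\ mc_proc (m := X) t w \in A].
have [E0|/set0P E0] := eqVneq E set0.
  left; split; first by rewrite /hitting_time -/E E0 image_set0 ereal_inf0.
  by move=> t t0; apply/negP => tA; have : set0 t by rewrite -E0.
right.
have lbE : lbound E 0 by move=> t [].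
have infE : has_inf E by split => //; exists 0.
pose t0 := inf E; have t00 : 0 <= t0 by exact: lb_le_inf.
have [e /= e0 He] := mc_right_continuous (m := X) w t00.
have const t : t0 < t -> t < t0 + e -> mc_proc (m := X) t w = mc_proc t0 w.
  move=> t0t tte; apply: He => //=.
  by rewrite distrC gtr0_norm ?subr_gt0//; lra.
have t0A : mc_proc (m := X) t0 w \in A.
  have [t Et tte] := inf_adherent e0 infE.
  have : t0 <= t by apply: ge_inf => //; exists 0.
  rewrite le_eqVlt => /orP[/eqP->|t0t]; first exact: Et.2.
  by rewrite -(const t)//; exact: Et.2.
exists t0, e; split => //.
- apply/eqP; rewrite eq_le; apply/andP; split.
    by apply: ereal_inf_lbound; exists t0.
  apply: le_ereal_inf_tmp => _ [t Et <-]; rewrite lee_fin.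
  by apply: ge_inf => //; exists 0.
- move=> t t_ge0 tt0; apply/negP => tA; move: tt0; apply/negP; rewrite -leNgt.
  by apply: ge_inf; [exists 0|].
- move=> t; rewrite le_eqVlt => /orP[/eqP<-//|t0t] tte.
  by rewrite const.
Qed.

Lemma cvg_grid_absorption w :
  (grid_absorption k w)%:E @[k --> \oo] -->
  (1 - expeR (- (lambda%:E * hitting_time A w)))%E.
Proof.
(* A path that never meets A survives at every grid time. *)
case: (hitting_timeP w) => [[-> alive]|[t0 [e [t00 e0 -> alive dead]]]].
  rewrite gt0_muley ?lte_fin//= sube0.
  have psiE k : grid_absorption k w = 1 - r k ^+ horizon k.
    apply/eqP; rewrite eq_le; apply/andP; split.
      by apply: grid_absorption_le => // i /andP[/leq_ltn_trans/[apply]]; rewrite ltnn.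
    apply: grid_absorption_ge => // i _ j _; apply: alive.
    by rewrite mulr_ge0// ltW.
  under eq_cvg do rewrite psiE.
  apply: cvg_EFin; first by near=> k.
  by rewrite -[X in _ --> X]subr0; apply: cvgB => //; exact: cvg_cst.
rewrite -EFinM -EFinN /= -EFinB.
apply: cvg_EFin; first by near=> k.
have shift (c : R) :
    1 - expR (- (lambda * (t0 + c * mesh k))) @[k --> \oo] --> 1 - expR (- (lambda * t0)).
  have arg : - (lambda * (t0 + c * mesh k)) @[k --> \oo] --> - (lambda * t0).
    apply: cvgN; apply: cvgM; first exact: cvg_cst.
    rewrite -[X in _ --> X]addr0.
    apply: cvgD; first exact: cvg_cst.
    by rewrite -[X in _ --> X](mulr0 c); apply: cvgM => //; exact: cvg_cst.
  apply: cvgB; first exact: cvg_cst.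
  have := @continuous_expR R (- (lambda * t0)).
  move=> ce; exact: (cvg_comp _ _ arg ce).
apply: squeeze_cvgr (shift (-1)) (shift 1); near=> k.
(* The first grid point strictly after t0 is in A, those strictly before t0 are
   not; the point m * mesh k may coincide with t0, so both m and m + 1 serve as
   bounds for the first grid index in A. *)
pose m := Num.truncn (t0 / mesh k).
have /andP[m_le m_gt] : m%:R <= t0 / mesh k < m.+1%:R.
  by apply: truncn_itv; rewrite divr_ge0 ?(ltW (mesh_gt0 _)).
rewrite ler_pdivlMr// in m_le; rewrite ltr_pdivrMr// in m_gt.
have mesh_e : mesh k < e by near: k; exact: (cvgr_lt _ cvg_mesh).
have t0k : t0 <= k%:R by near: k; exact: nbhs_infty_ger.
have mh : (m.+1 <= horizon k)%N.
  rewrite -(ler_nat R) -addn1 natrD /horizon natrM.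
  move: m_le; rewrite /mesh ler_pdivrMr// => m_le.
  have k0 : 0 <= k%:R :> R by [].
  move: m_le; rewrite -addn1 natrD; nra.
have rE j : r k ^+ j = expR (- (lambda * (j%:R * mesh k))).
  by rewrite /r -expRM_natr; congr expR; ring.
apply/andP; split.
  apply: (@le_trans _ _ (1 - r k ^+ m)).
    rewrite rE lerD2l lerN2 ler_expR lerN2 ler_pM2l//.
    move: m_gt; rewrite -addn1 natrD mulrDl; lra.
  apply: grid_absorption_ge; first exact: ltnW.
  move=> i im j ji; apply: alive; first by rewrite mulr_ge0// ltW.
  apply: lt_le_trans m_le; rewrite ltr_pM2r// ltr_nat.
  exact: leq_ltn_trans im.
apply: (@le_trans _ _ (1 - r k ^+ m.+1)).
  apply: grid_absorption_le => // i /andP[mi _] /(_ m.+1 mi) /negP; apply.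
  apply: dead; first exact: ltW.
  rewrite -addn1 natrD mulrDl mul1r; lra.
rewrite rE lerD2l lerN2 ler_expR lerN2 ler_pM2l//.
rewrite -addn1 natrD mulrDl; lra.
Unshelve. all: by end_near. Qed.

Lemma measurable_grid_absorption k : measurable_fun setT (grid_absorption k).
Proof.
apply: measurable_funM; first exact: measurable_cst.
apply: measurable_sum => i; apply: measurable_funM; first exact: measurable_cst.
by apply: measurable_indic; apply: measurable_grid_survival; exact: ltW.
Qed.

Lemma measurable_absorption :
  measurable_fun setT
    (fun w : mc_space X => 1 - expeR (- (lambda%:E * hitting_time A w)))%E.
Proof.
apply: (emeasurable_fun_cvg (fun k w => (grid_absorption k w)%:E)).
  by move=> k; apply/measurable_EFinP; exact: measurable_grid_absorption.
by move=> w _; exact: cvg_grid_absorption.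
Qed.

Lemma integral_grid_absorption k :
  (\int[mc_prob X]_w (grid_absorption k w)%:E)%E =
  ((1 - r k) * \sum_(0 <= i < horizon k) r k ^+ i *
    \sum_(y | y \notin A) killed_law (G := G) (mu := mu) A (mesh k) i y * 1)%:E.
Proof.
under eq_integral do rewrite /grid_absorption mulr_sumr -sumEFin.
rewrite ge0_integral_sum//; last 2 first.
- move=> i; apply/measurable_EFinP; apply: measurable_funM; first exact: measurable_cst.
  apply: measurable_funM; first exact: measurable_cst.
  by apply: measurable_indic; apply: measurable_grid_survival; exact: ltW.
- move=> i w _; rewrite lee_fin mulr_ge0 ?subr_ge0 ?(ltW (r_lt1 _))//.
  by rewrite mulr_ge0 ?exprn_ge0 ?(ltW (r_gt0 _)).
rewrite mulr_sumr -sumEFin; apply: eq_bigr => i _.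
under eq_integral do rewrite mulrA EFinM.
have mS : measurable (grid_survival X A (mesh k) i).
  by apply: measurable_grid_survival; exact: ltW.
rewrite ge0_integralZl_EFin//; last 2 first.
- by apply/measurable_EFinP; exact: measurable_indic.
- by rewrite mulr_ge0 ?exprn_ge0 ?subr_ge0 ?(ltW (r_lt1 _)) ?(ltW (r_gt0 _)).
rewrite integral_indic// setIT.
rewrite [X in (_ * X)%E](grid_survivalE X A (mesh k) (ltW (mesh_gt0 k)) i).
rewrite -EFinM mulrA; congr (_ * _)%:E.
by apply: eq_bigr => y _; rewrite mulr1.
Qed.

Lemma integral_absorption (u : T -> R) : hitting_equation G lambda A u ->
  (\int[mc_prob X]_w (1 - expeR (- (lambda%:E * hitting_time A w))))%E =
  (\sum_x mu x * u x)%:E.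
Proof.
move=> uP.
pose a k := (1 - r k) * \sum_(0 <= i < horizon k) r k ^+ i *
  \sum_(y | y \notin A) killed_law (G := G) (mu := mu) A (mesh k) i y * 1.
have a_cvg : a k @[k --> \oo] --> \sum_x mu x * u x.
  have bound0 : r k ^+ horizon k * (\sum_x `|u x|)
      + step_error (G := G) lambda u (mesh k) @[k --> \oo] --> 0.
    rewrite -[X in _ --> X]addr0; apply: cvgD (cvg_step_error u).
    by rewrite -[X in _ --> X](mul0r (\sum_x `|u x|)); apply: cvgM => //; exact: cvg_cst.
  apply/cvgrPdist_le => /= eps eps0; near=> k; rewrite distrC.
  apply: le_trans (discounted_survival_approx X A lambda u lambda_gt0 uP _
    (mesh_gt0 k) _) _.
  near: k; exact: (cvgr_le _ bound0).
have le1 k w : grid_absorption k w <= 1.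
  apply: (@le_trans _ _ (1 - r k ^+ horizon k)).
    by apply: grid_absorption_le => // i /andP[/leq_ltn_trans/[apply]]; rewrite ltnn.
  by rewrite gerBl exprn_ge0// ltW.
have [|||||_ _ lim_int] := @dominated_convergence _ _ _ (mc_prob X) setT measurableT
  (fun k w => (grid_absorption k w)%:E)
  (fun w => 1 - expeR (- (lambda%:E * hitting_time A w)))%E (EFin \o cst 1).
- by move=> k; apply/measurable_EFinP; exact: measurable_grid_absorption.
- exact: measurable_absorption.
- by apply: aeW => w _; exact: cvg_grid_absorption.
- exact: finite_measure_integrable_cst.
- by apply: aeW => w k _ /=; rewrite lee_fin ger0_norm.
have aE_cvg : (a k)%:E @[k --> \oo] --> (\sum_x mu x * u x)%:E.
  by apply: cvg_EFin => //; exact: nearW.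
apply: cvg_unique aE_cvg => //.
rewrite (_ : (fun k => (a k)%:E) =
  fun k => \int[mc_prob X]_w (grid_absorption k w)%:E)%E; first exact: lim_int.
by apply/funext => k; rewrite integral_grid_absorption.
Unshelve. all: by end_near. Qed.

Lemma absorption_bounds w :
  exists2 h : R, expeR (- (lambda%:E * hitting_time (X := X) A w)) = h%:E & 0 <= h <= 1.
Proof.
case: (hitting_timeP w) => [[-> _]|[t0 [e [t00 _ -> _ _]]]].
  by exists 0; rewrite ?lexx ?ler01// gt0_muley ?lte_fin.
exists (expR (- (lambda * t0))); first by rewrite -EFinM.
by rewrite expR_ge0 -[leRHS]expR0 ler_expR oppr_le0 mulr_ge0// ltW.
Qed.

Lemma hitting_laplaceE (u : T -> R) : hitting_equation G lambda A u ->
  hitting_laplace X lambda A = (1 - \sum_x mu x * u x)%:E.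
Proof.
move=> uP; have int_abs := integral_absorption u uP.
pose f w := expeR (- (lambda%:E * hitting_time (X := X) A w)).
have f_ge0 w : (0 <= f w)%E by exact: expeR_ge0.
have absK w : (1 - f w + f w = 1)%E.
  by rewrite /f; have [h -> _] := absorption_bounds w; rewrite -EFinB -EFinD subrK.
have abs_ge0 w : (0 <= 1 - f w)%E.
  rewrite /f; have [h -> /andP[_ h1]] := absorption_bounds w.
  by rewrite -EFinB lee_fin subr_ge0.
have mf : measurable_fun setT f.
  rewrite (_ : f = fun w => (1 - (1 - f w))%E); last first.
    apply/funext => w; rewrite /f; have [h -> _] := absorption_bounds w.
    by rewrite -!EFinB subKr.
  exact: emeasurable_funB (measurable_cst _) measurable_absorption.
have : (\int[mc_prob X]_w (1 - f w + f w) = 1)%E.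
  under eq_integral do rewrite absK.
  rewrite integral_cst// mul1e; exact: probability_setT.
rewrite ge0_integralD//; last exact: measurable_absorption.
rewrite int_abs -/(hitting_laplace X lambda A).
case: (hitting_laplace X lambda A) => [l| |]//= [] <-.
by rewrite addrAC subrr add0r.
Qed.

End Limit.

(** * Comparison of hitting times *)

Section HittingPeskun.
Context {R : realType} {T : finType}.
Variable pi : T -> R.
Hypothesis pi_gt0 : forall x, 0 < pi x.
Implicit Types (G : T -> T -> R) (u v : T -> R) (A : {set T}) (lambda : R).

(** [K] is [pi * (lambda - G)] on the complement of [A] and the identity on
    [A].  It is symmetric and injective, so by [symmetric_image] its image
    contains that of the identity matrix [I], that is everything. *)
Lemma hitting_equation_exists G A lambda : 0 < lambda ->
  is_reversible_generator pi G -> exists u, hitting_equation G lambda A u.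
Proof.
move=> l0 Gr.
pose K x y := if x \in A then (x == y)%:R else
  if y \in A then 0 else pi x * (lambda * (x == y)%:R - G x y).
pose I (x y : T) : R := (x == y)%:R.
have IE v x : apply_gen I v x = v x.
  rewrite /apply_gen (bigD1 x)//= /I eqxx mul1r big1 ?addr0// => y /negbTE.
  by rewrite eq_sym => ->; rewrite mul0r.
have KA v x : x \in A -> apply_gen K v x = v x.
  by move=> xA; rewrite -[RHS]IE; apply: eq_bigr => y _; rewrite /K xA.
have KnA v x : (forall y, y \in A -> v y = 0) -> x \notin A ->
    apply_gen K v x = pi x * (lambda * v x - apply_gen G v x).
  move=> vA xA; rewrite -{1}(IE v x) /apply_gen mulr_sumr -sumrB mulr_sumr.
  apply: eq_bigr => y _; rewrite /K (negbTE xA) /I; case: ifP => [/vA->|_]; ring.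
have KC x y : K x y = K y x.
  rewrite /K (eq_sym y x); have [->|xy] := eqVneq x y; first by [].
  rewrite !mulr0 !sub0r !mulrN Gr.2.
  by case: (x \in A); case: (y \in A).
have kerK v : (forall x, apply_gen K v x = 0) -> forall x, apply_gen I v x = 0.
  move=> Kv x; rewrite IE.
  have vA y : y \in A -> v y = 0 by move=> yA; rewrite -KA// Kv.
  have vnA y : y \notin A -> apply_gen G v y = lambda * v y.
    move=> yA; have /eqP := Kv y; rewrite KnA// mulf_eq0 (gt_eqF (pi_gt0 _))/=.
    by rewrite subr_eq0 => /eqP.
  have E : energy pi G v v = - \sum_y pi y * lambda * v y ^+ 2.
    congr (- _); apply: eq_bigr => y _; have [yA|yA] := boolP (y \in A).
      by rewrite vA//; ring.
    by rewrite vnA//; ring.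
  have t0 y : 0 <= pi y * lambda * v y ^+ 2.
    by rewrite mulr_ge0 ?sqr_ge0// ltW// mulr_gt0.
  have : \sum_y pi y * lambda * v y ^+ 2 == 0.
    rewrite eq_le sumr_ge0// andbT -oppr_ge0 -E.
    exact: energy_ge0.
  rewrite psumr_eq0// => /allP/(_ x (mem_index_enum _))/=.
  by rewrite mulf_eq0 sqrf_eq0 (gt_eqF (mulr_gt0 (pi_gt0 x) l0)) => /eqP.
have IC x y : I x y = I y x by rewrite /I eq_sym.
have [u uK] := symmetric_image _ _ IC KC kerK
  (fun x => if x \in A then 0 else lambda * pi x).
have uA x : x \in A -> u x = 0 by move=> xA; rewrite -KA// uK IE xA.
exists u; split => // x xA; apply: (mulfI (lt0r_neq0 (pi_gt0 x))).
by rewrite -KnA// uK IE (negbTE xA) mulrC.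
Qed.

(** The solution of the hitting equation represents the linear form
    [lambda <., 1>] for [lambda <f, g> + E (f, g)] on the functions that
    vanish on [A]. *)
Lemma hitting_equation_weak G A lambda u f : hitting_equation G lambda A u ->
  (forall x, x \in A -> f x = 0) ->
  lambda * (\sum_x pi x * (f x * u x)) + energy pi G f u =
  lambda * \sum_x pi x * f x.
Proof.
move=> [uA unA] fA; rewrite /energy !mulr_sumr -sumrB; apply: eq_bigr => x _.
have [/fA->|xA] := boolP (x \in A); first ring.
have -> : apply_gen G u x = lambda * u x - lambda by have := unA x xA; lra.
ring.
Qed.

(** With [Q_i (f, g) = lambda <f, g> + E_i (f, g)], the weak form gives
    [Q_i (u_i, u_i) = lambda <u_i, 1>] and [Q_1 (u2, u1) = lambda <u2, 1>].
    Expanding [0 <= Q_1 (u1 - u2, u1 - u2)] and bounding [Q_1 (u2, u2)] by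
    [Q_2 (u2, u2)] gives the claim. *)
Lemma hitting_equation_peskun G1 G2 A lambda u1 u2 : 0 < lambda ->
  is_reversible_generator pi G1 -> is_reversible_generator pi G2 ->
  peskun_le G1 G2 ->
  hitting_equation G1 lambda A u1 -> hitting_equation G2 lambda A u2 ->
  \sum_x pi x * u2 x <= \sum_x pi x * u1 x.
Proof.
move=> l0 G1r G2r G12 u1P u2P.
have W11 := hitting_equation_weak _ _ _ _ u1 u1P u1P.1.
have W12 := hitting_equation_weak _ _ _ _ u2 u1P u2P.1.
have W22 := hitting_equation_weak _ _ _ _ u2 u2P u2P.1.
have E12 := energy_peskun _ _ _ u2 pi_gt0 G1r G2r G12.
have := energy_ge0 _ _ (fun x => u1 x - u2 x) pi_gt0 G1r.
rewrite energyBl !energyBr (energyC _ _ u1 u2)//.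
have sq : \sum_x pi x * (u1 x * u1 x) - 2 * (\sum_x pi x * (u2 x * u1 x))
    + \sum_x pi x * (u2 x * u2 x) = \sum_x pi x * (u1 x - u2 x) ^+ 2.
  by rewrite mulr_sumr -sumrB -big_split; apply: eq_bigr => x _ /=; ring.
have sq0 : 0 <= \sum_x pi x * (u1 x - u2 x) ^+ 2.
  by apply: sumr_ge0 => x _; rewrite mulr_ge0 ?sqr_ge0 ?(ltW (pi_gt0 _)).
move: sq0; rewrite -sq -(pmulr_rge0 _ l0) mulrDr mulrBr => sq0 E0.
rewrite -(ler_pM2l l0); lra.
Qed.

Lemma hitting_laplace_peskun G1 G2 (X1 : markov_chain G1 pi)
    (X2 : markov_chain G2 pi) A lambda : 0 < lambda ->
  is_reversible_generator pi G1 -> is_reversible_generator pi G2 ->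
  peskun_le G1 G2 ->
  (hitting_laplace X1 lambda A <= hitting_laplace X2 lambda A)%E.
Proof.
move=> l0 G1r G2r G12.
have [u1 u1P] := hitting_equation_exists G1 A lambda l0 G1r.
have [u2 u2P] := hitting_equation_exists G2 A lambda l0 G2r.
rewrite (hitting_laplaceE X1 A lambda l0 u1)// (hitting_laplaceE X2 A lambda l0 u2)//.
by rewrite lee_fin lerD2l lerN2 (hitting_equation_peskun G1 G2 A lambda).
Qed.

End HittingPeskun.

(** * Expected hitting times *)

Section ExpectedHitting.
Context {R : realType} {T : finType} {G : T -> T -> R} {mu : T -> R}.
Variables (X : markov_chain G mu) (A : {set T}) (u : nat -> T -> R).
Hypothesis uP : forall k, hitting_equation G (2^-1 ^+ k) A (u k).

Let half_gt0 k : 0 < 2^-1 ^+ k :> R. Proof. by rewrite exprn_gt0. Qed.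

(** These functions increase to the hitting time; the parameters [2^-k] are
    halved at each step because this reduces monotonicity in [k] to a square
    being nonnegative. *)
Let rate k (w : mc_space X) : \bar R :=
  ((2 ^+ k)%:E * (1 - expeR (- ((2^-1 ^+ k)%:E * hitting_time A w))))%E.

Let rate_ge0 k w : (0 <= rate k w)%E.
Proof.
rewrite mule_ge0 ?lee_fin ?exprn_ge0//.
have [h -> /andP[_ h1]] := absorption_bounds X A _ (half_gt0 k) w.
by rewrite -EFinB lee_fin subr_ge0.
Qed.

(** With [s = exp (- t / 2^(k+1))] this is [1 - s^2 <= 2 (1 - s)]. *)
Let rate_nondecreasing w : nondecreasing_seq (rate^~ w).
Proof.
apply/nondecreasing_seqP => k; rewrite /rate.
case: (hitting_timeP X A w) => [[-> _]|[t [e [t0 _ -> _ _]]]].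
  rewrite !gt0_muley ?lte_fin//= !sube0 !mule1 lee_fin.
  by rewrite exprS ler_peMl ?exprn_ge0// ler1n.
rewrite -!EFinM lee_fin [2 ^+ k.+1]exprS -mulrA mulrCA ler_pM2l ?exprn_gt0//.
set s := expR (- (2^-1 ^+ k.+1 * t)).
have -> : expR (- (2^-1 ^+ k * t)) = s ^+ 2.
  by rewrite /s -expRM_natr exprS; congr expR; lra.
have := sqr_ge0 (1 - s); rewrite !expr2; lra.
Qed.

Let rate_cvg w : rate k w @[k --> \oo] --> hitting_time A w.
Proof.
rewrite /rate; case: (hitting_timeP X A w) => [[-> _]|[t [e [t0 _ -> _ _]]]].
  under eq_cvg do rewrite gt0_muley ?lte_fin ?exprn_gt0//= sube0 mule1.
  apply/cvgeryP/cvgryPge => B; near=> k.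
  apply: (@le_trans _ _ k%:R); first by near: k; exact: nbhs_infty_ger.
  by rewrite -natrX ler_nat ltnW// ltn_expl.
under eq_cvg do rewrite -EFinM.
apply: cvg_EFin; first exact: nearW.
have half_cvg : (2^-1 : R) ^+ k @[k --> \oo] --> 0.
  by apply: cvg_expr; rewrite gtr0_norm// invf_lt1// ltr1n.
have low : t - t ^+ 2 * 2^-1 ^+ k @[k --> \oo] --> t.
  rewrite -[X in _ --> X]subr0; apply: cvgB; first exact: cvg_cst.
  by rewrite -[X in _ --> X](mulr0 (t ^+ 2)); apply: cvgM => //; exact: cvg_cst.
apply: squeeze_cvgr low (cvg_cst _); apply: nearW => k.
(* The lower bound comes from 1 - exp (- x) >= x / (1 + x) >= x - x ^+ 2. *)
set y := 2^-1 ^+ k; have y0 : 0 < y by exact: half_gt0.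
have yV : 2 ^+ k * y = 1 by rewrite /y -exprMn mulfV// expr1n.
set q : R := 2 ^+ k in yV *; have q0 : 0 < q by rewrite exprn_gt0.
have yt0 : 0 <= y * t by rewrite mulr_ge0// ltW.
have e0 := expR_gt0 (- (y * t)).
have h1 := expR_ge1Dx (- (y * t)); have h2 := expR_ge1Dx (y * t).
have eV : expR (- (y * t)) * expR (y * t) = 1 by rewrite -expRD addNr expR0.
have tE : q * (y * t) = t by rewrite mulrA yV mul1r.
apply/andP; split; last first.
  rewrite -[leRHS]tE ler_pM2l//; lra.
have -> : t - t ^+ 2 * y = q * (y * t - (y * t) ^+ 2).
  by rewrite mulrBr tE expr2 mulrA tE; ring.
rewrite ler_pM2l//; nra.
Unshelve. all: by end_near. Qed.

Lemma cvg_expected_hitting_time :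
  (2 ^+ k * \sum_x mu x * u k x)%:E @[k --> \oo] --> expected_hitting_time X A.
Proof.
have rate_meas k : measurable_fun setT (rate k).
  apply: measurable_funeM; exact: measurable_absorption.
have rate_int k : (\int[mc_prob X]_w rate k w)%E = (2 ^+ k * \sum_x mu x * u k x)%:E.
  rewrite ge0_integralZl_EFin//; last 2 first.
  - move=> w _; have [h -> /andP[_ h1]] := absorption_bounds X A _ (half_gt0 k) w.
    by rewrite -EFinB lee_fin subr_ge0.
  - exact: measurable_absorption.
  by rewrite (integral_absorption X A _ (half_gt0 k) (u k)).
have := @cvg_monotone_convergence _ _ _ (mc_prob X) setT measurableT rate
  rate_meas (fun k w _ => rate_ge0 k w) (fun w _ => rate_nondecreasing w).
under eq_cvg do rewrite rate_int.
rewrite /expected_hitting_time.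
under eq_integral => w _ do rewrite (cvg_lim _ (rate_cvg w))//.
by [].
Qed.

End ExpectedHitting.

Lemma expected_hitting_time_ge0 {R : realType} {T : finType} {G : T -> T -> R}
    {mu : T -> R} (X : markov_chain G mu) (A : {set T}) :
  (0 <= expected_hitting_time X A)%E.
Proof.
by apply: integral_ge0 => w _; case: (hitting_timeP X A w) => [[->]|[t [e [t0 _ ->]]]].
Qed.

Section HittingConsequences.
Context {R : realType} {T : finType}.
Variable pi : T -> R.
Hypothesis pi_gt0 : forall x, 0 < pi x.
Implicit Types (G : T -> T -> R) (A : {set T}).

Lemma hitting_equations_exist G A : is_reversible_generator pi G ->
  exists u : nat -> T -> R, forall k, hitting_equation G (2^-1 ^+ k) A (u k).
Proof.
move=> Gr.
have ex k : exists u : T -> R, hitting_equation G (2^-1 ^+ k) A u.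
  by apply: (hitting_equation_exists pi) => //; rewrite exprn_gt0.
by exists (fun k => projT1 (cid (ex k))) => k; exact: projT2 (cid (ex k)).
Qed.

Lemma expected_hitting_time_peskun G1 G2 (X1 : markov_chain G1 pi)
    (X2 : markov_chain G2 pi) A :
  is_reversible_generator pi G1 -> is_reversible_generator pi G2 ->
  peskun_le G1 G2 ->
  (expected_hitting_time X2 A <= expected_hitting_time X1 A)%E.
Proof.
move=> G1r G2r G12.
have [u1 u1P] := hitting_equations_exist G1 A G1r.
have [u2 u2P] := hitting_equations_exist G2 A G2r.
have c1 := cvg_expected_hitting_time X1 A u1 u1P.
have c2 := cvg_expected_hitting_time X2 A u2 u2P.
rewrite -(cvg_lim _ c1)// -(cvg_lim _ c2)//.
apply: lee_lim; [exact: cvgP c2|exact: cvgP c1|apply: nearW => k].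
rewrite lee_fin ler_pM2l ?exprn_gt0//.
exact: (hitting_equation_peskun pi pi_gt0 G1 G2 A (2^-1 ^+ k)).
Qed.

(** The approximations of [cvg_expected_hitting_time] are linear in the initial
    law, since [u k] depends on the generator only. *)
Lemma expected_hitting_time_from_law G (X : markov_chain G pi)
    (Y : forall x, markov_chain G (point_mass x)) A :
  is_reversible_generator pi G ->
  expected_hitting_time X A =
  (\sum_x (pi x)%:E * expected_hitting_time (Y x) A)%E.
Proof.
move=> Gr; have [u uP] := hitting_equations_exist G A Gr.
apply: cvg_unique (cvg_expected_hitting_time X A u uP) _ => //.
have from x k : (\sum_z point_mass x z * u k z) = u k x.
  rewrite (bigD1 x)//= /point_mass eqxx mul1r big1 ?addr0// => z /negbTE->.
  by rewrite mul0r.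
have u_ge0 k x : 0 <= u k x.
  have k0 : 0 < 2^-1 ^+ k :> R by rewrite exprn_gt0.
  rewrite -lee_fin -(from x k) -(integral_absorption (Y x) A _ k0 (u k) (uP k)).
  apply: integral_ge0 => w _.
  have [h -> /andP[_ h1]] := absorption_bounds (Y x) A _ k0 w.
  by rewrite -EFinB lee_fin subr_ge0.
rewrite (_ : (fun k => _) =
    fun k => (\sum_x (pi x)%:E * (2 ^+ k * u k x)%:E)%E); last first.
  apply/funext => k; rewrite mulr_sumr -sumEFin; apply: eq_bigr => x _.
  by rewrite -EFinM mulrCA.
apply: cvg_nnesum => x _.
  by apply: nearW => k; rewrite -EFinM lee_fin !mulr_ge0 ?exprn_ge0// ltW.
apply: cvgeZl => //.
have := cvg_expected_hitting_time (Y x) A u uP.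
by under eq_cvg do rewrite from.
Qed.

Lemma average_hitting_timeE G (X : markov_chain G pi)
    (Y : forall x, markov_chain G (point_mass x)) :
  is_reversible_generator pi G ->
  average_hitting_time pi Y =
  (\sum_y (pi y)%:E * expected_hitting_time X [set y]%SET)%E.
Proof.
move=> Gr; rewrite /average_hitting_time exchange_big/=; apply: eq_bigr => y _.
rewrite (expected_hitting_time_from_law G X Y)// ge0_sume_distrr => [|x _].
  by apply: eq_bigr => x _; rewrite muleC [X in (_ * X)%E]muleC.
rewrite mule_ge0 ?lee_fin ?(ltW (pi_gt0 _))//.
exact: expected_hitting_time_ge0.
Qed.

Lemma average_hitting_time_peskun G1 G2 (X1 : markov_chain G1 pi)
    (X2 : markov_chain G2 pi)
    (Y1 : forall x, markov_chain G1 (point_mass x))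
    (Y2 : forall x, markov_chain G2 (point_mass x)) :
  is_reversible_generator pi G1 -> is_reversible_generator pi G2 ->
  peskun_le G1 G2 ->
  (average_hitting_time pi Y2 <= average_hitting_time pi Y1)%E.
Proof.
move=> G1r G2r G12.
rewrite (average_hitting_timeE G1 X1)// (average_hitting_timeE G2 X2)//.
apply: lee_sum => y _; apply: lee_wpmul2l; first by rewrite lee_fin ltW.
exact: expected_hitting_time_peskun.
Qed.

End HittingConsequences.

(** * The six reversiblizations *)

Section Exponents.
Context {R : realType} {T : finType}.
Variables (pi : T -> R) (L : T -> T -> R).
Hypotheses (pi_gt0 : forall x, 0 < pi x) (L_gen : is_generator L).
Let P := power_mean_reversiblization pi L.

Lemma sorted_exponents_peskun {D : Type} (r : rel D) (F : \bar R -> D) :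
  (forall p q, peskun_le (P p) (P q) -> r (F p) (F q)) ->
  sorted r [seq F p | p <- exponents R].
Proof.
move=> rF; rewrite sorted_exponents.
have S x y : x != y -> _ := reversiblization_sorted pi L pi_gt0 L_gen x y.
apply/and5P; split; apply: rF => x y /S;
  rewrite sorted_exponents => /and5P[h1 h2 h3 h4 h5].
- exact: h1.
- exact: h2.
- exact: h3.
- exact: h4.
- exact: h5.
Qed.

Lemma constant_exponents {D : eqType} (F : \bar R -> D) :
  (forall p q, F p = F q) -> constant [seq F p | p <- exponents R].
Proof.
move=> FE; rewrite /= (FE (-1)%:E -oo%E) (FE 0%:E -oo%E) (FE 1%:E -oo%E).
by rewrite (FE 2%:E -oo%E) (FE +oo%E -oo%E) eqxx.
Qed.

End Exponents.

Theorem corollary3p3 (R : realType) (T : finType) (pi : T -> R)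
    (pi_distr : is_positive_distribution pi)
    (L : T -> T -> R) (L_gen : is_generator L)
    (P := power_mean_reversiblization pi L)
    (* X p: the chain with generator P_p started from pi;
       Y p x: the chain with generator P_p started from x *)
    (X : forall p : \bar R, markov_chain (P p) pi)
    (Y : forall (p : \bar R) (x : T), markov_chain (P p) (point_mass x)) :
  (* (1) *)
  [/\ forall (lambda : R) (A : {set T}), 0 < lambda ->
        sorted <=%O [seq hitting_laplace (X p) lambda A | p <- exponents R],
      forall A : {set T},
        sorted >=%O [seq expected_hitting_time (X p) A | p <- exponents R]
    & sorted >=%O [seq average_hitting_time pi (Y p) | p <- exponents R]]
  /\
  (* (2) *)
  (sorted <=%O [seq spectral_gap (P p) pi | p <- exponents R] /\
   sorted >=%O [seq relaxation_time (P p) pi | p <- exponents R])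
  /\
  (* (3) *)
  (forall h : T -> R, mean pi h = 0 ->
     sorted >=%O [seq asymptotic_variance h (P p) pi | p <- exponents R])
  /\
  (* equality case *)
  (is_reversible_generator pi L ->
     (forall p x y, p \in exponents R -> P p x y = L x y) /\
     [/\ forall (lambda : R) (A : {set T}), 0 < lambda ->
           constant [seq hitting_laplace (X p) lambda A | p <- exponents R],
         forall A : {set T},
           constant [seq expected_hitting_time (X p) A | p <- exponents R]
       & constant [seq average_hitting_time pi (Y p) | p <- exponents R]]
     /\
     [/\ constant [seq spectral_gap (P p) pi | p <- exponents R],
         constant [seq relaxation_time (P p) pi | p <- exponents R]
       & forall h : T -> R, mean pi h = 0 ->
           constant [seq asymptotic_variance h (P p) pi | p <- exponents R]]).
Proof.
have pi_gt0 := pi_distr.1.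
have Pr p : is_reversible_generator pi (P p).
  exact: reversiblization_reversible.
split; [split|split; [split|split]].
- move=> lambda A l0; apply: (sorted_exponents_peskun pi L) => // p q pq.
  exact: (hitting_laplace_peskun pi pi_gt0 (P p) (P q)).
- move=> A; apply: (sorted_exponents_peskun pi L) => // p q pq.
  exact: (expected_hitting_time_peskun pi pi_gt0 (P p) (P q)).
- apply: (sorted_exponents_peskun pi L) => // p q pq.
  exact: (average_hitting_time_peskun pi pi_gt0 (P p) (P q)).
- apply: (sorted_exponents_peskun pi L) => // p q pq.
  exact: spectral_gap_peskun.
- apply: (sorted_exponents_peskun pi L) => // p q pq.
  exact: relaxation_time_peskun.
- move=> h _; apply: (sorted_exponents_peskun pi L) => // p q pq.
  exact: asymptotic_variance_peskun.
move=> Lr.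
have PL p : P p = L by exact: reversiblization_id.
have PP p q : peskun_le (P p) (P q) by move=> x y _; rewrite !PL.
split; first by move=> p x y _; rewrite PL.
split; split.
- move=> lambda A l0; apply: constant_exponents => p q; apply/eqP.
  by rewrite eq_le !(hitting_laplace_peskun pi).
- move=> A; apply: constant_exponents => p q; apply/eqP.
  by rewrite eq_le !(expected_hitting_time_peskun pi).
- apply: constant_exponents => p q; apply/eqP; rewrite eq_le.
  rewrite (average_hitting_time_peskun _ _ _ _ (X q) (X p))//.
  by rewrite (average_hitting_time_peskun _ _ _ _ (X p) (X q)).
- by apply: constant_exponents => p q; rewrite !PL.
- by apply: constant_exponents => p q; rewrite !PL.
- by move=> h _; apply: constant_exponents => p q; rewrite !PL.
Qed.
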